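(* Let $\mathbb{F}$ be a field and let $L_n^2$ be the graph on $\{1,\ldots,n\}$ with edges $\{i,i+1\}$ for $i=1,\ldots,n-1$ and $\{i,i+2\}$ for $i=1,\ldots,n-2$. Then $\mathbb{F}[\Delta_2^t(L^2_n)]$ is Cohen-Macaulay and has a linear resolution with Betti numbers $$\beta_{i,i+1}=(-1)^{i+1}\left(\binom{n}{i+1}-n\binom{n-1}{i}+(2n-3)\binom{n-2}{i-1}-(n-2)\binom{n-3}{i-2}\right),\qquad 1\le i\le n-3.$$ The clique complex of $L_n^2$ has Stanley-Reisner ring with linear resolution and with Betti numbers $$\beta_0=\beta_{0,0}=1,\qquad \beta_1=\beta_{1,n-2}=n-2,\qquad \beta_2=\beta_{2,n-1}=n-3,$$ and is Cohen-Macaulay.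
   Context: A simplicial complex on a finite set $V$ is a collection of subsets of $V$ closed under taking subsets. Its Stanley-Reisner ring over $\mathbb{F}$ is $\mathbb{F}[\Delta]=S/I_\Delta$, where $S=\mathbb{F}[x_v : v\in V]$ and $I_\Delta$ is generated by the monomials $\prod_{v\in F}x_v$ for all $F\subseteq V$ with $F\notin\Delta$; a complex is called Cohen-Macaulay if its Stanley-Reisner ring is. For a graph $G=(V,E)$, $\Delta_2^t(G)$ is the simplicial complex on $V$ whose facets are the complements $V\setminus M$ of the independent sets $M\subseteq V$ of size $2$ (independent: no two elements adjacent). The clique complex of $G$ is the simplicial complex on $V$ whose faces are the sets of pairwise adjacent vertices of $G$; it is the Alexander dual $\{F\subseteq V: V\setminus F\notin\Delta_2^t(G)\}$ of $\Delta_2^t(G)$. For a homogeneous ideal $I\subseteq S$, $\beta_{i,j}=\dim_{\mathbb{F}}\mathrm{Tor}^S_i(S/I,\mathbb{F})_j$ are the graded Betti numbers of $S/I$ and $\beta_i=\sum_j\beta_{i,j}$. $S/I$ has an $s$-linear resolution if $I$ is generated in degree $s$ and $\beta_{i,j}=0$ whenever $i\ge1$ and $j\ne s+i-1$; it has a linear resolution if it has an $s$-linear resolution for some $s$.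
   Formalization: False as printed (n=4: the ideal of Δ_2^t is (x_1,x_4), so β_{1,2}=0, not -1). Proved instead: the two Betti lists are exchanged between the complexes, (-1)^{i+1} becomes -1, β_{1,n-2} and β_{2,n-1} become β_{1,n-3} and β_{2,n-2}, and n≥4 is assumed. *)

(* Defs.v *)
From HB Require Import structures.
From mathcomp Require Import all_boot all_order all_algebra.
From mathcomp Require Export mpoly.
From mathcomp Require Import boolp classical_sets fsbigop.

Set Implicit Arguments.
Unset Strict Implicit.
Unset Printing Implicit Defensive.

Import GRing.Theory.
Local Open Scope ring_scope.

Section Graphs.

Variables (T : finType) (e : rel T).

Definition independent (M : {set T}) : bool :=
  [forall u in M, forall v in M, ~~ e u v].

Definition clique (A : {set T}) : bool :=
  [forall u in A, forall v in A, (u != v) ==> e u v].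

(* The complements of the independent k-sets all have the same cardinality, so
   they are exactly the facets of the complex they generate. *)
Definition total_cut_complex (k : nat) : {set {set T}} :=
  [set A : {set T} | [exists M : {set T},
             [&& independent M, #|M| == k & A \subset ~: M]]].

Definition clique_complex : {set {set T}} := [set A : {set T} | clique A].

End Graphs.

(* The vertices 1, ..., n are represented by 0, ..., n - 1. *)
Definition path_square (n : nat) : rel 'I_n := fun i j =>
  [|| j == i.+1 :> nat, j == i.+2 :> nat,
      i == j.+1 :> nat | i == j.+2 :> nat].
Arguments path_square n : clear implicits.

Local Open Scope classical_set_scope.

Section Ideals.

Variables (F : fieldType) (n : nat).
Local Notation S := {mpoly F[n]}.
Implicit Types (I G : set S).

Definition ideal_gen G : set S :=
  [set p | exists r (c g : 'I_r -> S),
     (forall k, G (g k)) /\ p = \sum_(k < r) c k * g k].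

Definition sr_ideal (D : {set {set 'I_n}}) : set S :=
  ideal_gen [set p | exists2 A : {set 'I_n},
    A \notin D & p = \prod_(v in A) 'X_v].

(* Prime ideals of S/I are the prime ideals of S that contain I. *)
Definition prime_chain I (d : nat) : Prop :=
  exists P : nat -> {pred S},
    (forall k, (k <= d)%N ->
       [/\ idealr_closed (P k), prime_idealr_closed (P k)
         & I `<=` [set` P k]]) /\
    (forall k, (k < d)%N -> [set` P k] `<` [set` P k.+1]).

Definition krull_dim I (d : nat) : Prop :=
  prime_chain I d /\ forall d', prime_chain I d' -> (d' <= d)%N.

(* The lift to S of the ideal generated by the first k terms of theta in S/I *)
Definition partial_ideal I (theta : seq S) (k : nat) : set S :=
  ideal_gen (I `|` [set` take k theta]).

Definition regular_sequence I (theta : seq S) : Prop :=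
  [/\ forall k, (k < size theta)%N ->
        exists2 d, (0 < d)%N & theta`_k \is d.-homog,
      forall k, (k < size theta)%N -> forall p,
        partial_ideal I theta k (theta`_k * p) -> partial_ideal I theta k p
    & ~ partial_ideal I theta (size theta) 1].

Definition depth I (d : nat) : Prop :=
  (exists2 theta, regular_sequence I theta & size theta = d) /\
  forall theta, regular_sequence I theta -> (size theta <= d)%N.

(* Cohen-Macaulayness of the standard graded algebra S/I, for I homogeneous:
   depth, with respect to the irrelevant ideal, equals Krull dimension. *)
Definition cohen_macaulay I : Prop :=
  exists2 d, krull_dim I d & depth I d.

(* Graded free resolution of S/I by modules of finite rank: the i-th module has
   a basis whose a-th element has degree gr_deg a. Its elements are row vectors,
   so gr_diff i, from the (i+1)-st module to the i-th one, acts by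
   multiplication on the right. *)
Record graded_resolution I := GradedResolution {
  gr_rank : nat -> nat;
  gr_deg : forall i, 'I_(gr_rank i) -> nat;
  gr_aug : 'cV[S]_(gr_rank 0);
  gr_diff : forall i, 'M[S]_(gr_rank i.+1, gr_rank i);
  gr_aug_homog : forall a, gr_aug a 0 \is (gr_deg a).-homog;
  gr_diff_homog : forall i a b m, m \in msupp (gr_diff i a b) ->
    (mdeg m + gr_deg b)%N = gr_deg a;
  gr_aug_surj : exists v : 'rV[S]_(gr_rank 0), I ((v *m gr_aug) 0 0 - 1);
  gr_exact0 : forall v : 'rV[S]_(gr_rank 0),
    I ((v *m gr_aug) 0 0) <-> exists w, v = w *m gr_diff 0;
  gr_exactS : forall i (v : 'rV[S]_(gr_rank i.+1)),
    v *m gr_diff i = 0 <-> exists w, v = w *m gr_diff i.+1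
}.

Section Tor.

Variables (I : set S) (P : graded_resolution I).

(* P tensored with F = S/(x_v): only the constant terms of the entries remain. *)
Definition tor_diff i : 'M[F]_(gr_rank P i.+1, gr_rank P i) :=
  map_mx (mcoeff 0%MM) (gr_diff P i).

(* Its row space is the component of degree j of the i-th module. *)
Definition tor_component i j : 'M[F]_(gr_rank P i) :=
  diag_mx (\row_a (gr_deg a == j)%:R).

Definition tor_cycles i j : 'M[F]_(gr_rank P i) :=
  match i with
  | 0 => tor_component 0 j
  | i'.+1 => (tor_component i'.+1 j :&: kermx (tor_diff i'))%MS
  end.

Definition tor_boundaries i j : 'M[F]_(gr_rank P i.+1, gr_rank P i) :=
  tor_component i.+1 j *m tor_diff i.

Definition tor_dim i j : nat :=
  (\rank (tor_cycles i j) - \rank (tor_boundaries i j))%N.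

End Tor.

(* dim_F Tor_i(S/I, F)_j, computed from any graded free resolution of S/I *)
Definition betti I (i j : nat) : nat :=
  xget 0%N [set b | exists P : graded_resolution I, b = tor_dim P i j].

Definition total_betti I (i : nat) : nat :=
  \big[addn/0%N]_(j \in [set: nat]) betti I i j.

Definition generated_in_degree I (s : nat) : Prop :=
  I = ideal_gen [set p | I p /\ p \is s.-homog].

Definition s_linear_resolution I (s : nat) : Prop :=
  generated_in_degree I s /\
  forall i j, (1 <= i)%N -> j != (s + i - 1)%N -> betti I i j = 0%N.

Definition linear_resolution I : Prop := exists s, s_linear_resolution I s.

End Ideals.

Arguments sr_ideal F {n} D.

(* Binomial coefficient with integer lower index, zero when it is negative;
   truncated subtraction on nat would give 'C(m, 1 - 2) = 1. *)
Definition binz (m : nat) (k : int) : int :=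
  if k is Posz k' then 'C(m, k')%:Z else 0.

(* Main.v *)
Require Import Defs.
From HB Require Import structures.
From mathcomp Require Import all_boot all_order all_algebra.
From mathcomp Require Import zify ring.
From mathcomp Require Import boolp classical_sets fsbigop.
(* Imported again last, so that set0, setIS, setU1, etc. denote the notions for
   finite sets and not those of classical_sets. *)
From mathcomp Require Import fintype finset.

(* Both ideals have linear quotients: there is an ordering of squarefree
   monomial generators x^{B_1}, ..., x^{B_m} such that each colon ideal
   (x^{B_1}, ..., x^{B_{k-1}}) : x^{B_k} is generated by a set V_k of variables.
   For the clique complex the generators are x_a x_b with a + 3 <= b, and V is
   {v < a} U {a + 3 <= v < b}; for the cut complex they are the products of all
   variables outside {k, k+1, k+2}, and V is {k+2}, or empty for k = 0.
   Iterated mapping cones over the Koszul complexes of the V_k then give a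
   linear resolution with i-th Betti number the sum of the binomials
   'C(#|V_k|, i - 1), and any two graded resolutions are homotopy equivalent,
   so that this computes Tor.
   The two complexes are Alexander dual, and linear quotients of an ideal are
   the same datum as a shelling of the dual complex, whose facets are the
   complements of the B_k and whose restriction sets are the V_k. Along the
   shelling, regularity of the elementary symmetric polynomials e_1, ..., e_d
   reduces to the quotient by the variables outside one facet. There e_1, ...,
   e_{d-1} form, by induction, a regular sequence modulo each variable x_v of
   the facet; hence x_v is regular modulo e_1, ..., e_{d-1}, and so is e_d,
   which is the product of these x_v.
   Krull dimension and depth are bounded above by one counting argument: along
   a chain of primes, or of the ideals defined by a regular sequence, one finds
   f_1, ..., f_r whose monomials are linearly independent modulo I, and there is
   no room for them when r exceeds the size of the faces. *)

Set Implicit Arguments.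
Unset Strict Implicit.
Unset Printing Implicit Defensive.

Import GRing.Theory.
Local Open Scope ring_scope.

(** * Ideals of polynomials and squarefree monomial ideals *)

Section Ideals.

Variables (F : fieldType) (n : nat).
Local Notation S := {mpoly F[n]}.
Implicit Types (J K : set S) (p q f g : S) (A B : {set 'I_n}) (U : pred {set 'I_n}).
Local Open Scope classical_set_scope.

Definition is_ideal J : Prop :=
  J 0 /\ forall a p q, J p -> J q -> J (a * p + q).

Definition adjoin J f : set S := [set p | exists q, J (p - q * f)].

Definition homog_closed J : Prop :=
  forall d p, J p -> J (pihomog mdeg d p).

Lemma is_ideal0 J : is_ideal J -> J 0.
Proof. by case. Qed.

Lemma is_idealM J a p : is_ideal J -> J p -> J (a * p).
Proof. by case=> J0 JL Jp; rewrite -[_ * _]addr0; apply: JL. Qed.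

Lemma is_idealMr J a p : is_ideal J -> J p -> J (p * a).
Proof. by move=> JI Jp; rewrite mulrC; apply: is_idealM. Qed.

Lemma is_idealD J p q : is_ideal J -> J p -> J q -> J (p + q).
Proof. by case=> _ JL Jp Jq; rewrite -[p]mul1r; apply: JL. Qed.

Lemma is_idealN J p : is_ideal J -> J p -> J (- p).
Proof. by move=> JI Jp; rewrite -mulN1r; apply: is_idealM. Qed.

Lemma is_idealB J p q : is_ideal J -> J p -> J q -> J (p - q).
Proof. by move=> JI Jp Jq; apply: is_idealD => //; apply: is_idealN. Qed.

Lemma is_ideal_sum J (I : Type) (r : seq I) (P : pred I) (G : I -> S) :
  is_ideal J -> (forall i, P i -> J (G i)) -> J (\sum_(i <- r | P i) G i).
Proof.
move=> JI JG; elim/big_rec: _ => [|i x Pi Jx]; first exact: is_ideal0.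
by apply: is_idealD => //; apply: JG.
Qed.

Lemma is_ideal_eqmod J p q : is_ideal J -> J (p - q) -> J p <-> J q.
Proof.
move=> JI Jpq; split=> [Jp|Jq].
  by rewrite -[q](subKr p); apply: is_idealB.
by rewrite -[p](subrK q); apply: is_idealD.
Qed.

Lemma adjoin_ideal J f : is_ideal J -> is_ideal (adjoin J f).
Proof.
move=> JI; split; first by exists 0; rewrite mul0r subr0; apply: is_ideal0.
move=> a p q [u Ju] [v Jv]; exists (a * u + v).
have -> : a * p + q - (a * u + v) * f = a * (p - u * f) + (q - v * f) by ring.
by apply: is_idealD => //; apply: is_idealM.
Qed.

Lemma sub_adjoin J f p : J p -> adjoin J f p.
Proof. by move=> Jp; exists 0; rewrite mul0r subr0. Qed.

Lemma mem_adjoin J f q : is_ideal J -> adjoin J f (q * f).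
Proof. by move=> JI; exists q; rewrite subrr; apply: is_ideal0. Qed.

Lemma adjoinC J f g : adjoin (adjoin J f) g = adjoin (adjoin J g) f.
Proof.
by apply/seteqP; split=> p [u [v Jv]]; exists v, u; rewrite addrAC.
Qed.

Lemma sub_ideal_gen (G : set S) J :
  is_ideal J -> G `<=` J -> ideal_gen G `<=` J.
Proof.
move=> JI GJ _ [r [c [g [Gg ->]]]].
by apply: is_ideal_sum => // k _; apply: is_idealM => //; apply: GJ.
Qed.

Lemma mem_ideal_gen (G : set S) p : G p -> ideal_gen G p.
Proof.
move=> Gp; exists 1%N, (fun=> 1), (fun=> p); split=> //.
by rewrite big_ord1 mul1r.
Qed.

Lemma ideal_gen_ideal (G : set S) : is_ideal (ideal_gen G).
Proof.
split.
  exists 0%N, (fun=> 0), (fun=> 0); split; first by case.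
  by rewrite big_ord0.
move=> a _ _ [r [c [g [Gg ->]]]] [r' [c' [g' [Gg' ->]]]].
exists (r + r')%N.
exists (fun k => match split k with inl i => a * c i | inr j => c' j end).
exists (fun k => match split k with inl i => g i | inr j => g' j end).
split; first by move=> k; case: (split k).
rewrite big_split_ord /= mulr_sumr; congr (_ + _); apply: eq_bigr => i _.
  by rewrite (unsplitK (inl i)) mulrA.
by rewrite (unsplitK (inr i)).
Qed.

Lemma mcoeff_pihomog d p m :
  (pihomog mdeg d p)@_m = if mdeg m == d then p@_m else 0.
Proof.
rewrite pihomogE (raddf_sum (mcoeff m)) /= big_mkcond /=.
transitivity (\sum_(m' <- msupp p) (if m' == m then
   (if mdeg m == d then p@_m else 0) else 0)).
  apply: eq_bigr => m' _; case: (eqVneq m' m) => [->|ne].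
    by rewrite mcoeffZ mcoeffX eqxx mulr1.
  by rewrite mcoeffZ mcoeffX (negPf ne) mulr0 if_same.
rewrite -big_mkcond /=; case: (boolP (m \in msupp p)) => ms.
  rewrite (eq_bigl (pred1 m)) // -big_filter filter_pred1_uniq ?msupp_uniq //.
  by rewrite big_seq1.
by rewrite (memN_msupp_eq0 ms) if_same big1.
Qed.

Lemma pihomogM_lt d e p f : f \is e.-homog -> (d < e)%N ->
  pihomog mdeg d (p * f) = 0.
Proof.
move=> fh lt_de; apply/mpolyP => m; rewrite mcoeff_pihomog mcoeff0.
case: eqP => // md; apply: memN_msupp_eq0; apply/negP => /msuppM_le.
case/allpairsP => -[m1 m2] /= [_ m2f mE].
by move: lt_de; rewrite -md mE mdegD (dhomog_mf fh m2f) ltnNge leq_addl.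
Qed.

Lemma pihomogM d e p f : f \is e.-homog ->
  pihomog mdeg (d + e) (p * f) = pihomog mdeg d p * f.
Proof.
move=> fh; rewrite [in LHS](mpolyE p) [in RHS](mpolyE p).
rewrite mulr_suml !(linear_sum (pihomog mdeg _)) mulr_suml /=; apply: eq_bigr => m _.
rewrite -scalerAl !linearZ /= -scalerAl; congr (_ *: _).
rewrite pihomogX.
have hX : 'X_[m] * f \is (mdeg m + e).-homog.
  by apply: dhomogM => //; rewrite dhomogX.
case: eqVneq => [<-|ne]; first by rewrite pihomog_dE.
by rewrite mul0r (pihomog_ne0 _ hX) // eqn_add2r.
Qed.

Lemma adjoin_homog J e f : is_ideal J -> homog_closed J -> f \is e.-homog ->
  homog_closed (adjoin J f).
Proof.
move=> JI Jh fh d p [q Jq]; have := Jh d _ Jq; rewrite linearB /=.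
case: (leqP e d) => [le_ed|lt_de].
  by rewrite -(subnK le_ed) pihomogM // => Jd; exists (pihomog mdeg (d - e) q).
by rewrite (pihomogM_lt _ fh) // subr0; apply: sub_adjoin.
Qed.

Definition mnm_supp (m : 'X_{1..n}) : {set 'I_n} := [set i | m i != 0%N]%SET.

Definition mnm_ind A : 'X_{1..n} := [multinom (i \in A : nat) | i < n].

Definition setmon A : S := 'X_[mnm_ind A].

(* The squarefree monomial ideal whose monomials are those with support in U,
   for U closed upwards. *)
Definition support_ideal (U : pred {set 'I_n}) : set S :=
  [set p | forall m, m \in msupp p -> U (mnm_supp m)].

Definition up_closed (U : pred {set 'I_n}) : Prop :=
  forall A B, A \subset B -> U A -> U B.

Lemma mnm_suppD m1 m2 : mnm_supp (m1 + m2) = mnm_supp m1 :|: mnm_supp m2.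
Proof. by apply/setP => i; rewrite !inE mnmDE addn_eq0 negb_and. Qed.

Lemma mnm_supp_ind A : mnm_supp (mnm_ind A) = A.
Proof. by apply/setP => i; rewrite inE mnmE; case: (i \in A). Qed.

Lemma setmon_prod A : setmon A = \prod_(v in A) 'X_v.
Proof.
rewrite /setmon [LHS]mpolyXE_id [RHS]big_mkcond /=. apply: eq_bigr => i _.
by rewrite mnmE; case: (i \in A).
Qed.

Lemma mdeg_ind A : mdeg (mnm_ind A) = #|A|.
Proof.
rewrite mdegE -sum1_card [RHS]big_mkcond /=; apply: eq_bigr => i _.
by rewrite mnmE; case: (i \in A).
Qed.

Lemma setmon_homog A : setmon A \is #|A|.-homog.
Proof. by rewrite dhomogX; apply/eqP/mdeg_ind. Qed.

Lemma setmon_dvd A m : A \subset mnm_supp m ->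
  'X_[m] = 'X_[m - mnm_ind A] * setmon A :> S.
Proof.
move=> sAm; rewrite -mpolyXD submK //; apply/mnm_lepP => i; rewrite mnmE.
by case: (boolP (i \in A)) => // /(fintype.subsetP sAm); rewrite inE lt0n.
Qed.

Lemma support_ideal_ideal U : up_closed U -> is_ideal (support_ideal U).
Proof.
move=> Uup; split=> [m|a p q Up Uq m]; first by rewrite msupp0.
move/msuppD_le; rewrite mem_cat => /orP[/msuppM_le|/Uq //].
case/allpairsP => -[m1 m2] /= [_ m2p ->].
by apply: Uup (Up _ m2p); rewrite mnm_suppD finset.subsetUr.
Qed.

Lemma support_idealX U m : support_ideal U 'X_[m] <-> U (mnm_supp m).
Proof.
split=> [|Um m']; first by apply; rewrite msuppX mem_seq1.
by rewrite msuppX mem_seq1 => /eqP ->.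
Qed.

Lemma support_ideal_sub U J : is_ideal J ->
  (forall m, U (mnm_supp m) -> J 'X_[m]) -> support_ideal U `<=` J.
Proof.
move=> JI UJ p Up; rewrite [p]mpolyE big_seq; apply: is_ideal_sum => // m mp.
by rewrite -mul_mpolyC; apply: is_idealM => //; apply/UJ/Up.
Qed.

Lemma support_ideal_homog U : homog_closed (support_ideal U).
Proof.
move=> d p Up m; rewrite mcoeff_msupp mcoeff_pihomog.
by case: ifP; rewrite ?eqxx // -mcoeff_msupp => _ /Up.
Qed.

Lemma support_ideal_colon U A p :
  support_ideal U (p * setmon A) <-> support_ideal (fun B => U (B :|: A)) p.
Proof.
split=> Up m mp.
  rewrite -(mnm_supp_ind A) -mnm_suppD; apply: Up.
  by rewrite (perm_mem (msuppMX _ _)) addmC; apply: map_f.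
move: mp; rewrite (perm_mem (msuppMX _ _)) => /mapP [m' m'p ->].
by rewrite addmC mnm_suppD mnm_supp_ind; apply: Up.
Qed.

Lemma eq_support_ideal U U' : U =1 U' -> support_ideal U = support_ideal U'.
Proof.
by move=> UU'; apply/seteqP; split=> p Up m /Up; rewrite UU'.
Qed.

Lemma adjoin_support U A : up_closed U ->
  adjoin (support_ideal U) (setmon A) =
  support_ideal (fun B => U B || (A \subset B)).
Proof.
move=> Uup; have U'up : up_closed (fun B => U B || (A \subset B)).
  move=> B C sBC /orP[/(Uup _ _ sBC) -> //|sAB].
  by rewrite (fintype.subset_trans sAB sBC) orbT.
have U'I := support_ideal_ideal U'up.
apply/seteqP; split.
  move=> p [q Upq]; rewrite -[p](subrK (q * setmon A)).
  apply: (is_idealD U'I); first by move=> m /Upq ->.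
  apply: (is_idealM _ U'I).
  by apply/support_idealX; rewrite mnm_supp_ind fintype.subxx orbT.
apply: support_ideal_sub; first exact/adjoin_ideal/support_ideal_ideal.
move=> m /orP[Um|sAm]; first exact/sub_adjoin/support_idealX.
by rewrite (setmon_dvd sAm); apply/mem_adjoin/support_ideal_ideal.
Qed.

Lemma sr_ideal_support (D : {set {set 'I_n}}) :
  (forall A B, A \subset B -> B \in D -> A \in D) ->
  sr_ideal F D = support_ideal (fun A => A \notin D).
Proof.
move=> Ddown; have Uup : up_closed (fun A => A \notin D).
  by move=> A B sAB; apply: contra; apply: Ddown.
apply/seteqP; split.
  apply: sub_ideal_gen; first exact: support_ideal_ideal.
  move=> _ [A AD ->]; rewrite -setmon_prod; apply/support_idealX.
  by rewrite mnm_supp_ind.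
apply: support_ideal_sub; first exact: ideal_gen_ideal.
move=> m mD; rewrite (setmon_dvd (fintype.subxx _)).
apply: is_idealM; first exact: ideal_gen_ideal.
by apply: mem_ideal_gen; exists (mnm_supp m) => //; rewrite setmon_prod.
Qed.

End Ideals.

(** * Graded matrices and lifting *)

Lemma dependent_sequence (T : nat -> Type) (R : forall i, T i -> T i.+1 -> Prop)
    (x0 : T 0%N) (x1 : T 1%N) : R 0%N x0 x1 ->
  (forall i x y, R i x y -> exists z, R i.+1 y z) ->
  exists f : forall i, T i, f 0%N = x0 /\ forall i, R i (f i) (f i.+1).
Proof.
move=> R01 step.
pose G i := {xy : T i * T i.+1 | R i xy.1 xy.2}.
have next i (u : G i) : {z | R i.+1 (sval u).2 z}.
  by apply: cid; case: u => -[x y] /= /step.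
pose h := fix h i : G i := match i with
  | 0 => exist _ (x0, x1) R01
  | i'.+1 => exist _ ((sval (h i')).2, sval (next i' (h i')))
                     (svalP (next i' (h i')))
  end.
exists (fun i => (sval (h i)).1); split=> // i.
exact: (svalP (h i)).
Qed.

Section GradedMatrices.

Variables (F : fieldType) (n : nat).
Local Notation S := {mpoly F[n]}.

Definition homog_mx a b (dr : 'I_a -> nat) (dc : 'I_b -> nat) (A : 'M[S]_(a, b)) :=
  forall i j m, m \in msupp (A i j) -> (mdeg m + dc j)%N = dr i.

Definition homog_part a b (dr : 'I_a -> nat) (dc : 'I_b -> nat)
    (A : 'M[S]_(a, b)) : 'M[S]_(a, b) :=
  \matrix_(i, j) if (dc j <= dr i)%N then pihomog mdeg (dr i - dc j) (A i j)
                 else 0.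

Section Basics.

Variables (a b : nat) (dr : 'I_a -> nat) (dc : 'I_b -> nat).
Implicit Types A B : 'M[S]_(a, b).

Lemma homog_part_homog A : homog_mx dr dc (homog_part dr dc A).
Proof.
move=> i j m; rewrite mxE; case: leqP => [le_cr|_]; last by rewrite msupp0.
by move/(dhomog_mf (pihomogP _ _ _)) ->; rewrite subnK.
Qed.

Lemma homog_mx_entry A i j : homog_mx dr dc A ->
  A i j != 0 -> (dc j <= dr i)%N /\ A i j \is (dr i - dc j).-homog.
Proof.
move=> hA nz; split; first by rewrite -(hA _ _ _ (mlead_supp nz)) leq_addl.
by apply/dhomogP => m /hA <-; rewrite addnK.
Qed.

Lemma homog_part_id A : homog_mx dr dc A -> homog_part dr dc A = A.
Proof.
move=> hA; apply/matrixP => i j; rewrite mxE.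
have [->|/(homog_mx_entry hA)[-> hAij]] := eqVneq (A i j) 0.
  by rewrite pihomog0 if_same.
by rewrite pihomog_dE.
Qed.

Lemma homog_mxD A B : homog_mx dr dc A -> homog_mx dr dc B ->
  homog_mx dr dc (A + B).
Proof.
move=> hA hB i j m; rewrite mxE => /msuppD_le.
by rewrite mem_cat => /orP[/hA|/hB].
Qed.

Lemma homog_mxN A : homog_mx dr dc A -> homog_mx dr dc (- A).
Proof. by move=> hA i j m; rewrite mxE (perm_mem (msuppN _)); apply: hA. Qed.

Lemma homog_mxB A B : homog_mx dr dc A -> homog_mx dr dc B ->
  homog_mx dr dc (A - B).
Proof. by move=> hA hB; apply: homog_mxD => //; apply: homog_mxN. Qed.

End Basics.

Lemma homog_part_mulmx a b c dr dc de (A : 'M[S]_(a, b)) (B : 'M[S]_(b, c)) :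
  homog_mx dc de B -> homog_part dr de (A *m B) = homog_part dr dc A *m B.
Proof.
move=> hB; apply/matrixP => i j; rewrite !mxE.
transitivity (\sum_k (if (de j <= dr i)%N
    then pihomog mdeg (dr i - de j) (A i k * B k j) else 0)).
  case: ifP => _; last by rewrite big1.
  exact: (linear_sum (pihomog mdeg _)).
apply: eq_bigr => k _; rewrite mxE.
have [->|/(homog_mx_entry hB)[le_ec hBkj]] := eqVneq (B k j) 0.
  by rewrite !mulr0 pihomog0 if_same.
case: (leqP (dc k) (dr i)) => [le_cr|lt_rc].
  rewrite (leq_trans le_ec le_cr) -(pihomogM _ _ hBkj); congr (pihomog _ _ _).
  lia.
by case: ifP => le_er; rewrite mul0r // (pihomogM_lt _ hBkj) //; lia.
Qed.

Lemma homog_mxM a b c dr dc de (A : 'M[S]_(a, b)) (B : 'M[S]_(b, c)) :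
  homog_mx dr dc A -> homog_mx dc de B -> homog_mx dr de (A *m B).
Proof.
move=> hA hB; rewrite -(homog_part_id hA) -(homog_part_mulmx _ _ hB).
exact: homog_part_homog.
Qed.

Lemma homog_mx1 a (dr : 'I_a -> nat) : homog_mx dr dr 1%:M.
Proof.
move=> i j m; rewrite mxE; case: eqP => [->|_]; last by rewrite msupp0.
by rewrite msupp1 mem_seq1 => /eqP ->; rewrite mdeg0.
Qed.

Lemma homog_lift a b c dr dc de (X : 'M[S]_(a, c)) (D : 'M[S]_(b, c)) :
    homog_mx dr de X -> homog_mx dc de D ->
    (forall i, exists w, row i X = w *m D) ->
  exists W : 'M[S]_(a, b), homog_mx dr dc W /\ X = W *m D.
Proof.
move=> hX hD /fin_all_exists [w wE].
pose W := \matrix_i w i.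
have XE : X = W *m D by apply/row_matrixP => i; rewrite row_mul rowK.
exists (homog_part dr dc W); split; first exact: homog_part_homog.
by rewrite -(homog_part_mulmx _ _ hD) -XE homog_part_id.
Qed.

Section Lifting.

Variables (rP rQ : nat -> nat).
Variables (gP : forall i, 'I_(rP i) -> nat) (gQ : forall i, 'I_(rQ i) -> nat).
Variables (dP : forall i, 'M[S]_(rP i.+1, rP i)).
Variables (dQ : forall i, 'M[S]_(rQ i.+1, rQ i)).
Hypothesis (dPP : forall i, dP i.+1 *m dP i = 0).
Hypothesis (hP : forall i, homog_mx (gP (i := _)) (gP (i := _)) (dP i)).
Hypothesis (hQ : forall i, homog_mx (gQ (i := _)) (gQ (i := _)) (dQ i)).
Hypothesis (exQ : forall i (v : 'rV[S]_(rQ i.+1)),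
  v *m dQ i = 0 -> exists w, v = w *m dQ i.+1).

Lemma lift_chain_map (X0 : 'M[S]_(rP 0, rQ 0)) :
    homog_mx (gP (i := _)) (gQ (i := _)) X0 ->
    (forall i, exists w, row i (dP 0 *m X0) = w *m dQ 0) ->
  exists X : forall i, 'M[S]_(rP i, rQ i),
    [/\ X 0 = X0, forall i, homog_mx (gP (i := _)) (gQ (i := _)) (X i)
      & forall i, dP i *m X i = X i.+1 *m dQ i].
Proof.
move=> h0 /(homog_lift (homog_mxM (@hP 0%N) h0) (@hQ 0%N)) [X1 [h1 E1]].
pose R i (x : 'M[S]_(rP i, rQ i)) (y : 'M[S]_(rP i.+1, rQ i.+1)) :=
  [/\ homog_mx (gP (i := _)) (gQ (i := _)) x,
      homog_mx (gP (i := _)) (gQ (i := _)) y & dP i *m x = y *m dQ i].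
have [|i x y [hx hy xy]|X [X0E XR]] := @dependent_sequence _ R X0 X1.
- by split.
- have [|z [hz zE]] := homog_lift (homog_mxM (@hP i.+1) hy) (@hQ i.+1).
    move=> k; apply: exQ; rewrite -row_mul -mulmxA -xy mulmxA dPP mul0mx.
    by rewrite row0.
  by exists z; split.
by exists X; split=> // i; case: (XR i).
Qed.

End Lifting.

Section Homotopy.

Variables (r : nat -> nat) (g : forall i, 'I_(r i) -> nat).
Variables (d : forall i, 'M[S]_(r i.+1, r i)) (u : forall i, 'M[S]_(r i)).
Hypothesis (hd : forall i, homog_mx (g (i := _)) (g (i := _)) (d i)).
Hypothesis (dd : forall i, d i.+1 *m d i = 0).
Hypothesis (exd : forall i (v : 'rV[S]_(r i.+1)),
  v *m d i = 0 -> exists w, v = w *m d i.+1).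
Hypothesis (hu : forall i, homog_mx (g (i := _)) (g (i := _)) (u i)).
Hypothesis (du : forall i, d i *m u i = u i.+1 *m d i).

Lemma null_homotopy : (forall i, exists w, row i (u 0) = w *m d 0) ->
  exists h : forall i, 'M[S]_(r i, r i.+1),
    [/\ forall i, homog_mx (g (i := _)) (g (i := _)) (h i), u 0 = h 0 *m d 0
      & forall i, u i.+1 = d i *m h i + h i.+1 *m d i.+1].
Proof.
case/(homog_lift (@hu 0%N) (@hd 0%N)) => h0 [hh0 h0E].
have step i x : homog_mx (g (i := _)) (g (i := _)) x ->
    d i *m (u i - x *m d i) = 0 ->
  exists z, homog_mx (g (i := _)) (g (i := _)) z /\
    u i.+1 = d i *m x + z *m d i.+1.
  move=> hx ux0; have hdx := homog_mxM (@hd i) hx.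
  have [|z [hz zE]] := homog_lift (homog_mxB (@hu i.+1) hdx) (@hd i.+1).
    move=> k; apply: exd; rewrite -row_mul mulmxBl -du -mulmxA -mulmxBr ux0.
    by rewrite row0.
  by exists z; split=> //; rewrite -zE addrC subrK.
have [|h1 [hh1 h1E]] := step 0 h0 hh0; first by rewrite h0E subrr mulmx0.
pose R i (x : 'M[S]_(r i, r i.+1)) (y : 'M[S]_(r i.+1, r i.+2)) :=
  [/\ homog_mx (g (i := _)) (g (i := _)) x,
      homog_mx (g (i := _)) (g (i := _)) y
    & u i.+1 = d i *m x + y *m d i.+1].
have [|i x y [hx hy xy]|h [h0E' hR]] := @dependent_sequence _ R h0 h1.
- by split.
- have [|z [hz zE]] := step i.+1 y hy; last by exists z; split.
  by rewrite xy addrK mulmxA dd mul0mx.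
exists h; split=> [i||i]; rewrite ?h0E' //; by case: (hR i).
Qed.

End Homotopy.

End GradedMatrices.

(** * Independence of Tor from the resolution *)

Section Subquotients.

Variables (F : fieldType).

Lemma subquotient_le a b (f : 'M[F]_(a, b)) za ba zb bb (ZA : 'M[F]_(za, a))
    (BA : 'M[F]_(ba, a)) (ZB : 'M[F]_(zb, b)) (BB : 'M[F]_(bb, b)) :
    (BA <= ZA)%MS -> (BB <= ZB)%MS -> (ZA *m f <= ZB)%MS ->
    (forall z : 'rV_a, (z <= ZA)%MS -> (z *m f <= BB)%MS -> (z <= BA)%MS) ->
  (\rank ZA - \rank BA <= \rank ZB - \rank BB)%N.
Proof.
move=> sBZA sBZB sZAB inj; set C := (ZA :\: BA)%MS.
have sCZ : (C <= ZA)%MS by apply: diffmxSl.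
have capC : (C :&: BA = 0)%MS by apply/eqP; rewrite capmx_diff.
have zC0 (z : 'rV_a) : (z <= C)%MS -> (z *m f <= BB)%MS -> z = 0.
  move=> zC zfB; apply/eqP; rewrite -submx0 -capC sub_capmx zC.
  by apply: inj zfB; apply: submx_trans sCZ.
have rC : \rank C = (\rank ZA - \rank BA)%N.
  by rewrite -(mxrank_cap_compl ZA BA) (capmx_idPr sBZA) addKn.
have rCf : \rank (C *m f) = \rank C.
  apply/mxrank_injP; rewrite -submx0; apply/rV_subP => z.
  rewrite sub_capmx => /andP[zC /sub_kermxP zf0].
  by rewrite submx0; apply/eqP/zC0; rewrite ?zf0 ?sub0mx.
have capf : (C *m f :&: BB = 0)%MS.
  apply/eqP; rewrite -submx0; apply/rV_subP => w; rewrite sub_capmx.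
  case/andP=> /submxP [D ->]; rewrite mulmxA => wB.
  by rewrite (zC0 (D *m C)) ?submxMl // mul0mx sub0mx.
have : (\rank (C *m f) + \rank BB <= \rank ZB)%N.
  rewrite -(mxrank_disjoint_sum capf) mxrankS // addsmx_sub sBZB andbT.
  by apply: submx_trans sZAB; apply: submxMr.
by rewrite rCf rC; lia.
Qed.

End Subquotients.

Section TorIndependence.

Variables (F : fieldType) (n : nat) (I : set {mpoly F[n]}).
Local Notation S := {mpoly F[n]}.
Hypotheses (II : is_ideal I) (Ih : homog_closed I).

Definition ideal_mx a (A : 'cV[S]_a) := forall k, I (A k 0).

Lemma ideal_mx_mull a b (B : 'M[S]_(b, a)) A : ideal_mx A -> ideal_mx (B *m A).
Proof.
move=> IA k; rewrite mxE; apply: is_ideal_sum => // j _.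
exact: is_idealM.
Qed.

Lemma ideal_mxD a (A B : 'cV[S]_a) : ideal_mx A -> ideal_mx B ->
  ideal_mx (A + B).
Proof. by move=> IA IB k; rewrite mxE; apply: is_idealD. Qed.

Lemma ideal_mx_part a (dr : 'I_a -> nat) (A : 'cV[S]_a) : ideal_mx A ->
  ideal_mx (homog_part dr (fun=> 0%N) A).
Proof. by move=> IA k; rewrite mxE leq0n; apply: Ih. Qed.

Lemma gr_aug_homog_mx (P : graded_resolution I) :
  homog_mx (gr_deg (g := P) (i := 0%N)) (fun=> 0%N) (gr_aug P).
Proof.
move=> a b m; rewrite (ord1 b) addn0 => ma.
by apply: dhomog_mf ma; apply: gr_aug_homog.
Qed.

Lemma gr_diff_homog_mx (P : graded_resolution I) i :
  homog_mx (gr_deg (g := P) (i := _)) (gr_deg (g := P) (i := _)) (gr_diff P i).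
Proof. by move=> a b m; apply: gr_diff_homog. Qed.

Lemma gr_diffM (P : graded_resolution I) i : gr_diff P i.+1 *m gr_diff P i = 0.
Proof.
apply/row_matrixP => k; rewrite row_mul row0.
by apply/gr_exactS; exists (delta_mx 0 k); rewrite rowE.
Qed.

Lemma gr_diff_aug (P : graded_resolution I) : ideal_mx (gr_diff P 0 *m gr_aug P).
Proof.
move=> k; have -> : (gr_diff P 0 *m gr_aug P) k 0 =
    (row k (gr_diff P 0) *m gr_aug P) 0 0.
  by rewrite -row_mul [RHS]mxE.
by apply/gr_exact0; exists (delta_mx 0 k); rewrite rowE.
Qed.

Lemma gr_exact0_row (P : graded_resolution I) a (A : 'M[S]_(a, gr_rank P 0)) :
  ideal_mx (A *m gr_aug P) -> forall k, exists w, row k A = w *m gr_diff P 0.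
Proof.
move=> IA k; apply/gr_exact0; rewrite -row_mul mxE; exact: IA.
Qed.

Lemma lift_aug (P : graded_resolution I) a (dr : 'I_a -> nat) (c : 'cV[S]_a) :
    homog_mx dr (fun=> 0%N) c ->
  exists X : 'M[S]_(a, gr_rank P 0),
    homog_mx dr (gr_deg (g := P) (i := 0%N)) X /\ ideal_mx (X *m gr_aug P - c).
Proof.
move=> hc; have [v Iv] := gr_aug_surj P.
exists (homog_part dr (gr_deg (g := P) (i := 0%N)) (c *m v)).
split; first exact: homog_part_homog.
rewrite -(homog_part_mulmx _ _ (@gr_aug_homog_mx P)).
rewrite -[X in _ - X](homog_part_id hc).
have -> : homog_part dr (fun=> 0%N) (c *m v *m gr_aug P) -
    homog_part dr (fun=> 0%N) c =
    homog_part dr (fun=> 0%N) (c *m (v *m gr_aug P - 1%:M)).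
  rewrite mulmxBr mulmx1 mulmxA; apply/matrixP => i j.
  by rewrite !mxE leq0n -linearB; congr (pihomog _ _ _); rewrite !mxE.
apply: ideal_mx_part; apply: ideal_mx_mull => k.
by rewrite (ord1 k); move: Iv; rewrite !mxE.
Qed.

Lemma comparison_map (P Q : graded_resolution I) :
  exists X : forall i, 'M[S]_(gr_rank P i, gr_rank Q i),
    [/\ forall i, homog_mx (gr_deg (g := P) (i := _))
                    (gr_deg (g := Q) (i := _)) (X i),
        forall i, gr_diff P i *m X i = X i.+1 *m gr_diff Q i
      & ideal_mx (X 0%N *m gr_aug Q - gr_aug P)].
Proof.
have [X0 [hX0 X0E]] := lift_aug Q (@gr_aug_homog_mx P).
have [||X [XE hX XQ]] := @lift_chain_map _ _ _ _ _ (@gr_deg _ _ _ Q) _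
  (gr_diff Q) (gr_diffM P) (@gr_diff_homog_mx P) (@gr_diff_homog_mx Q) _ X0 hX0.
- by move=> i v' /gr_exactS.
- apply: gr_exact0_row; rewrite -mulmxA.
  rewrite -[X0 *m _](subrK (gr_aug P)) mulmxDr.
  by apply: (ideal_mxD _ (@gr_diff_aug P)); apply: ideal_mx_mull.
by exists X; rewrite XE; split.
Qed.

Definition const_mx0 a b (A : 'M[S]_(a, b)) : 'M[F]_(a, b) :=
  map_mx (mcoeff 0%MM) A.

Definition degree_diag a (dr : 'I_a -> nat) (j : nat) : 'M[F]_a :=
  diag_mx (\row_k (dr k == j)%:R).

Lemma degree_diag_idem a (dr : 'I_a -> nat) j :
  degree_diag dr j *m degree_diag dr j = degree_diag dr j.
Proof.
rewrite mulmx_diag; congr diag_mx; apply/rowP => k; rewrite !mxE.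
by case: (_ == _); rewrite ?mulr1 ?mulr0.
Qed.

Lemma degree_diag_sub a (dr : 'I_a -> nat) j b (A : 'M[F]_(b, a)) :
  (A <= degree_diag dr j)%MS = (A *m degree_diag dr j == A).
Proof.
apply/idP/eqP => [/submxP [D ->]|<-]; last exact: submxMl.
by rewrite -mulmxA degree_diag_idem.
Qed.

Lemma degree_diag_comm a b (dr : 'I_a -> nat) (dc : 'I_b -> nat)
    (A : 'M[S]_(a, b)) j : homog_mx dr dc A ->
  degree_diag dr j *m const_mx0 A = const_mx0 A *m degree_diag dc j.
Proof.
move=> hA; apply/matrixP => i k; rewrite mul_diag_mx mul_mx_diag !mxE.
have [->|nz] := eqVneq ((A i k)@_0%MM) 0; first by rewrite mulr0 mul0r.
have := hA i k 0%MM; rewrite mcoeff_msupp nz mdeg0 add0n => <- //.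
by rewrite mulrC.
Qed.

Lemma const_mx0M a b c (A : 'M[S]_(a, b)) (B : 'M[S]_(b, c)) :
  const_mx0 (A *m B) = const_mx0 A *m const_mx0 B.
Proof. exact: map_mxM. Qed.

Lemma tor_dim_le (P Q : graded_resolution I) i j :
  (tor_dim P i j <= tor_dim Q i j)%N.
Proof.
have [f [hf df fI]] := comparison_map P Q.
have [g [hg dg gI]] := comparison_map Q P.
pose u i := f i *m g i - 1%:M.
have hu k : homog_mx (gr_deg (g := P) (i := _)) (gr_deg (g := P) (i := _)) (u k).
  by apply: homog_mxB (homog_mxM (hf k) (hg k)) (@homog_mx1 _ _ _ _).
have du k : gr_diff P k *m u k = u k.+1 *m gr_diff P k.
  by rewrite mulmxBr mulmxBl mulmx1 mul1mx mulmxA df -mulmxA dg mulmxA.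
have uI : ideal_mx (u 0%N *m gr_aug P).
  have -> : u 0%N *m gr_aug P = f 0%N *m (g 0%N *m gr_aug P - gr_aug Q) +
      (f 0%N *m gr_aug Q - gr_aug P).
    by rewrite mulmxBr mulmxBl mul1mx addrA subrK mulmxA.
  by apply: (ideal_mxD _ fI); apply: ideal_mx_mull.
have [|h [hh h0 hS]] := null_homotopy (@gr_diff_homog_mx P) (gr_diffM P) _ hu du
  (gr_exact0_row uI); first by move=> k v /gr_exactS.
have fgE k : const_mx0 (f k) *m const_mx0 (g k) = const_mx0 (u k) + 1%:M.
  by rewrite -const_mx0M /const_mx0 map_mxB map_mx1 subrK.
have df' k : tor_diff P k *m const_mx0 (f k) = const_mx0 (f k.+1) *m tor_diff Q k.
  by rewrite -[tor_diff P k]/(const_mx0 _) -[tor_diff Q k]/(const_mx0 _)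
    -!const_mx0M df.
have dg' k : tor_diff Q k *m const_mx0 (g k) = const_mx0 (g k.+1) *m tor_diff P k.
  by rewrite -[tor_diff P k]/(const_mx0 _) -[tor_diff Q k]/(const_mx0 _)
    -!const_mx0M dg.
have dd (R : graded_resolution I) k : tor_diff R k.+1 *m tor_diff R k = 0.
  rewrite -[tor_diff R k]/(const_mx0 _) -[tor_diff R k.+1]/(const_mx0 _).
  by rewrite -const_mx0M gr_diffM /const_mx0 map_mx0.
have dE (R : graded_resolution I) k : tor_component R k.+1 j *m tor_diff R k =
    tor_diff R k *m tor_component R k j.
  exact: (degree_diag_comm j (@gr_diff_homog_mx R k)).
have BC (R : graded_resolution I) k :
    (tor_boundaries R k j <= tor_component R k j)%MS.
  by rewrite /tor_boundaries dE submxMl.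
have BZ (R : graded_resolution I) : (tor_boundaries R i j <= tor_cycles R i j)%MS.
  case: i => [|i']; first exact: BC.
  rewrite sub_capmx BC; apply/sub_kermxP.
  by rewrite -mulmxA dd mulmx0.
apply: (@subquotient_le _ _ _ (const_mx0 (f i))) => //.
  have fC k : (tor_component P k j *m const_mx0 (f k) <= tor_component Q k j)%MS.
    by rewrite [X in (X <= _)%MS](degree_diag_comm j (hf k)) submxMl.
  case: (i) => [|i']; first exact: fC.
  rewrite sub_capmx; apply/andP; split.
    by apply: submx_trans (fC _); apply/submxMr/capmxSl.
  apply/sub_kermxP; rewrite -mulmxA -df' mulmxA.
  by rewrite (sub_kermxP (capmxSr _ _)) mul0mx.
move=> z zZ zfB.
have zC : z *m tor_component P i j = z.
  apply/eqP; rewrite -degree_diag_sub; apply: submx_trans zZ _.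
  by case: (i) => // i'; apply: capmxSl.
have zfgB : (z *m const_mx0 (f i) *m const_mx0 (g i) <= tor_boundaries P i j)%MS.
  apply: submx_trans (submxMr _ zfB) _.
  rewrite -mulmxA dg' mulmxA.
  rewrite [X in (X *m _ <= _)%MS](degree_diag_comm j (hg i.+1)) -mulmxA.
  exact: submxMl.
have hB : (z *m const_mx0 (h i) *m tor_diff P i <= tor_boundaries P i j)%MS.
  rewrite -zC -[z *m _ *m _]mulmxA.
  rewrite [X in (_ *m X *m _ <= _)%MS](degree_diag_comm j (hh i)) mulmxA -mulmxA.
  exact: submxMl.
suff uE : z *m const_mx0 (u i) = z *m const_mx0 (h i) *m tor_diff P i.
  have -> : z = z *m const_mx0 (f i) *m const_mx0 (g i) -
                z *m const_mx0 (h i) *m tor_diff P i.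
    by rewrite -mulmxA fgE mulmxDr mulmx1 uE addrC addKr.
  by rewrite addmx_sub // eqmx_opp.
clear BZ zfgB hB zfB zC; case: i z zZ => [|i'] z zZ.
  by rewrite h0 const_mx0M mulmxA.
have -> : const_mx0 (u i'.+1) = tor_diff P i' *m const_mx0 (h i') +
    const_mx0 (h i'.+1) *m tor_diff P i'.+1.
  by rewrite hS [LHS]map_mxD; congr (_ + _); apply: const_mx0M.
rewrite mulmxDr.
move: zZ; rewrite sub_capmx => /andP[_ /sub_kermxP zd].
by rewrite mulmxA zd mul0mx add0r mulmxA.
Qed.

Lemma tor_dim_eq (P Q : graded_resolution I) i j : tor_dim P i j = tor_dim Q i j.
Proof. by apply/eqP; rewrite eqn_leq !tor_dim_le. Qed.

Lemma betti_tor_dim (P : graded_resolution I) i j : betti I i j = tor_dim P i j.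
Proof.
rewrite /betti; case: xgetP => [b _ [Q ->]|/(_ (tor_dim P i j))].
  exact: tor_dim_eq.
by case; exists P.
Qed.

End TorIndependence.

(** * Mapping cones *)

Section MappingCone.

Variables (F : fieldType) (n : nat) (I J : set {mpoly F[n]}) (f : {mpoly F[n]}).
Variable (s : nat).
Local Notation S := {mpoly F[n]}.
Hypothesis (II : is_ideal I).
Hypothesis (colon : forall p, J p <-> I (p * f)).
Variables (P : graded_resolution I) (Q : graded_resolution J).

Definition cone_rank i := match i with
  | 0 => gr_rank P 0
  | i'.+1 => (gr_rank P i'.+1 + gr_rank Q i')%N
  end.

Definition cone_deg i : 'I_(cone_rank i) -> nat := match i with
  | 0 => gr_deg (g := P) (i := 0)
  | i'.+1 => fun a => match split a with
      | inl b => gr_deg b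
      | inr b => (gr_deg b + s)%N
      end
  end.

Variable (X : forall i, 'M[S]_(gr_rank Q i, gr_rank P i)).

Definition cone_diff i : 'M[S]_(cone_rank i.+1, cone_rank i) := match i with
  | 0 => col_mx (gr_diff P 0) (X 0)
  | i'.+1 => block_mx (gr_diff P i'.+1) 0 (X i'.+1) (- gr_diff Q i')
  end.

Local Notation shifted_degQ i := (fun b : 'I_(gr_rank Q i) => (gr_deg b + s)%N).

Hypothesis (hX : forall i,
  homog_mx (shifted_degQ i) (gr_deg (g := P) (i := i)) (X i)).
Hypothesis (dX : forall i, gr_diff Q i *m X i = X i.+1 *m gr_diff P i).
Hypothesis (XI : ideal_mx I (X 0 *m gr_aug P - f *: gr_aug Q)).

Lemma cone_diff_homog i :
  homog_mx (cone_deg (i := _)) (cone_deg (i := _)) (cone_diff i).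
Proof.
have hP := @gr_diff_homog_mx _ _ _ P; have hQ := @gr_diff_homog_mx _ _ _ Q.
move=> a b m; case: i a b => [|i] a b /=; rewrite !mxE.
  by case: (split a) => a'; [apply: hP | apply: hX].
case: (split a) => a'; rewrite !mxE; case: (split b) => b'.
- exact: hP.
- by rewrite mxE msupp0.
- exact: hX.
- by rewrite mxE (perm_mem (msuppN _)) => /hQ <-; rewrite addnA.
Qed.

Lemma cone_lift i (a : 'rV_(gr_rank P i.+1)) (b : 'rV_(gr_rank Q i)) c :
    a *m gr_diff P i + b *m X i = 0 -> b = c *m gr_diff Q i ->
  exists w, row_mx a b = w *m cone_diff i.+1.
Proof.
move=> abX bE; move: abX; rewrite {1}bE -mulmxA dX mulmxA -mulmxDl.
case/gr_exactS => w wE; exists (row_mx w (- c)).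
rewrite /= mul_row_block mulmx0 add0r !mulNmx mulmxN opprK -bE -wE.
by rewrite addrK.
Qed.

Lemma aug_colon (b : 'rV_(gr_rank Q 0)) :
  I ((b *m X 0 *m gr_aug P) 0 0) <-> J ((b *m gr_aug Q) 0 0).
Proof.
apply: iff_trans (iff_sym (colon _)).
apply: is_ideal_eqmod => //.
have := @ideal_mx_mull _ _ _ II _ _ b _ XI 0.
rewrite mulmxBr -scalemxAr mulmxA.
by rewrite !mxE mulrC.
Qed.

Lemma cone_exact0 (v : 'rV_(gr_rank P 0)) :
  adjoin I f ((v *m gr_aug P) 0 0) <-> exists w, v = w *m cone_diff 0.
Proof.
have XIb (b : 'rV_(gr_rank Q 0)) :
    I ((b *m X 0 *m gr_aug P) 0 0 - (b *m gr_aug Q) 0 0 * f).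
  have := @ideal_mx_mull _ _ _ II _ _ b _ XI 0.
  by rewrite mulmxBr -scalemxAr mulmxA !mxE mulrC.
split=> [[q vq]|[w ->]].
  have [vQ /colon vQE] := gr_aug_surj Q.
  have : I (((v - q *: vQ *m X 0) *m gr_aug P) 0 0).
    rewrite mulmxBl mxE [X in _ + X]mxE.
    have -> : (v *m gr_aug P) 0 0 - (q *: vQ *m X 0 *m gr_aug P) 0 0 =
      ((v *m gr_aug P) 0 0 - q * f) - q * (((vQ *m gr_aug Q) 0 0 - 1) * f) -
      ((q *: vQ *m X 0 *m gr_aug P) 0 0 - (q *: vQ *m gr_aug Q) 0 0 * f).
      by rewrite -(scalemxAl q vQ (gr_aug Q)) [(q *: (vQ *m _)) 0 0]mxE; ring.
    by apply: is_idealB (XIb _) => //; apply: is_idealB => //; apply: is_idealM.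
  case/gr_exact0 => w wE; exists (row_mx w (q *: vQ)).
  by rewrite /= mul_row_col -wE subrK.
rewrite -[w]hsubmxK /= mul_row_col mulmxDl mxE.
apply: is_idealD; first exact: adjoin_ideal.
  by apply/sub_adjoin/gr_exact0; exists (lsubmx w).
by exists ((rsubmx w *m gr_aug Q) 0 0).
Qed.

Lemma cone_exactS i (v : 'rV_(cone_rank i.+1)) :
  v *m cone_diff i = 0 <-> exists w, v = w *m cone_diff i.+1.
Proof.
split; last first.
  case=> w ->; rewrite -mulmxA -[RHS](mulmx0 _ w); congr (_ *m _).
  case: i {v w} => [|i] /=.
    rewrite mul_block_col mul0mx addr0 gr_diffM mulNmx dX subrr.
    by rewrite -[RHS]vsubmxK !linear0.
  rewrite mulmx_block !(mul0mx, mulmx0, addr0, add0r) gr_diffM mulNmx dX subrr.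
  rewrite mulNmx mulmxN opprK gr_diffM.
  by rewrite block_mx0.
case: i v => [|i] v.
  rewrite -[v]hsubmxK /= mul_row_col => vX.
  have /gr_exact0[c cE] : J ((rsubmx v *m gr_aug Q) 0 0).
    apply/aug_colon; have -> : rsubmx v *m X 0 = - lsubmx v *m gr_diff P 0.
      by apply/eqP; rewrite mulNmx -addr_eq0 addrC vX.
    by apply/gr_exact0; exists (- lsubmx v).
  exact: (@cone_lift 0 _ _ c).
rewrite -[v]hsubmxK /= mul_row_block mulmx0 add0r.
rewrite -[RHS]hsubmxK !linear0 => /eq_row_mx[vX].
rewrite mulmxN => /eqP; rewrite oppr_eq0 => /eqP/gr_exactS[c cE].
exact: (@cone_lift i.+1 _ _ c).
Qed.

Definition cone : graded_resolution (adjoin I f).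
Proof.
refine (@GradedResolution _ _ _ cone_rank cone_deg (gr_aug P) cone_diff
  _ (fun i a b m => @cone_diff_homog i a b m) _ cone_exact0 cone_exactS).
  exact: gr_aug_homog.
by have [v Iv] := gr_aug_surj P; exists v; apply: sub_adjoin.
Defined.

End MappingCone.

Section LinearResolutions.

Variables (F : fieldType) (n : nat).
Local Notation S := {mpoly F[n]}.
Implicit Types (I J : set S) (s : nat) (r : nat -> nat).

Definition linear_degree s i := if i is i'.+1 then (s + i')%N else 0%N.

Definition has_linear_resolution I s r : Prop :=
  exists P : graded_resolution I, (forall i, gr_rank P i = r i) /\
    forall i (a : 'I_(gr_rank P i)), gr_deg a = linear_degree s i.

Lemma eq_linear_resolution I s r r' : has_linear_resolution I s r -> r =1 r' ->
  has_linear_resolution I s r'.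
Proof. by move=> [P [rP dP]] rr'; exists P; split=> // i; rewrite -rr'. Qed.

Lemma zero_ideal_resolution s :
  has_linear_resolution (support_ideal (F := F) pred0) s (fun i => i == 0%N).
Proof.
pose I : set S := support_ideal pred0.
have I0 p : I p <-> p = 0.
  split=> [Ip|->]; last by move=> m; rewrite msupp0.
  apply/eqP; case: (eqVneq p 0) => // /mlead_supp /Ip //.
pose r i := nat_of_bool (i == 0%N).
unshelve refine (ex_intro _ (@GradedResolution _ _ I r (fun i _ => linear_degree s i)
  (const_mx 1) (fun i => 0) _ _ _ _ _) _); rewrite /r /=.
- by move=> a; rewrite mxE; apply: dhomog1.
- by move=> i a b m; rewrite mxE msupp0.
- exists (const_mx 1); apply/I0.
  by rewrite !mxE big_ord1 !mxE mulr1 subrr.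
- move=> v; rewrite I0 mxE big_ord1 mxE mulr1; split=> [v0|[w ->]].
    by exists 0; apply/rowP => k; rewrite mulmx0 (ord1 k) v0 mxE.
  by rewrite mulmx0 mxE.
- move=> i v; split=> [_|_]; last by rewrite mulmx0.
  by exists 0; apply/rowP => -[].
by split=> // i a.
Qed.

Lemma cone_linear_resolution I J f s r r' :
    is_ideal I -> homog_closed I -> f \is s.-homog ->
    (forall p, J p <-> I (p * f)) ->
    has_linear_resolution I s r -> has_linear_resolution J 1 r' ->
  has_linear_resolution (adjoin I f) s
    (fun i => if i is i'.+1 then (r i + r' i')%N else r 0%N).
Proof.
move=> II Ih fh colon [P [rP dP]] [Q [rQ dQ]].
pose sQ i := fun b : 'I_(gr_rank Q i) => (gr_deg b + s)%N.
have hfQ : homog_mx (sQ 0%N) (fun=> 0%N) (f *: gr_aug Q).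
  move=> a b m; rewrite mxE (ord1 b) addn0 /sQ addnC.
  by move/(dhomog_mf (dhomogM fh (gr_aug_homog a))).
have hdQ i : homog_mx (sQ i.+1) (sQ i) (gr_diff Q i).
  by move=> a b m /gr_diff_homog; rewrite /sQ => <-; rewrite addnA.
have [X0 [hX0 X0E]] := lift_aug II Ih P hfQ.
have [||X [XE hX XP]] := @lift_chain_map _ _ _ _ sQ (@gr_deg _ _ _ P) (gr_diff Q)
  (gr_diff P) (gr_diffM Q) hdQ (@gr_diff_homog_mx _ _ _ P) _ X0 hX0.
- by move=> i v' /gr_exactS.
- apply: (gr_exact0_row (P := P)); rewrite -mulmxA.
  rewrite -[X0 *m _](subrK (f *: gr_aug Q)) mulmxDr.
  apply: (ideal_mxD II); first exact: ideal_mx_mull.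
  move=> k; rewrite -scalemxAr mxE mulrC; apply/colon; exact: gr_diff_aug.
rewrite -XE in X0E.
exists (cone II colon hX XP X0E); split=> [[|i]|[|i] a] /=.
- exact: rP.
- by rewrite rP rQ.
- exact: (dP 0%N a).
- case: (split a) => b; first exact: (dP i.+1 b).
  by rewrite dQ; case: (i) => [|i'] /=; lia.
Qed.

Lemma linear_resolution_tor I s r (P : graded_resolution I) i j : (0 < s)%N ->
    (forall i, gr_rank P i = r i) ->
    (forall i (a : 'I_(gr_rank P i)), gr_deg a = linear_degree s i) ->
  tor_dim P i j = if j == linear_degree s i then r i else 0%N.
Proof.
move=> s_gt0 rP dP.
have d0 k : tor_diff P k = 0.
  apply/matrixP => a b; rewrite !mxE; apply: memN_msupp_eq0.
  apply/negP => /gr_diff_homog; rewrite mdeg0 !dP.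
  by case: k {a b} => [|k] /=; lia.
have C k : tor_component P k j = (j == linear_degree s k)%:R%:M.
  by apply/matrixP => a b; rewrite !mxE dP (eq_sym (linear_degree s k)).
have -> : tor_dim P i j = \rank (tor_component P i j).
  rewrite /tor_dim /tor_boundaries d0 mulmx0 mxrank0 subn0.
  case: (i) => //= k; apply: eqmx_rank.
  rewrite capmxSl sub_capmx submx_refl /=.
  by apply/sub_kermxP; rewrite d0 mulmx0.
by rewrite C -rP; case: (_ == _); rewrite ?mxrank1 // raddf0 mxrank0.
Qed.

Lemma linear_resolution_betti I s r i j : is_ideal I -> homog_closed I ->
    (0 < s)%N -> has_linear_resolution I s r ->
  betti I i j = if j == linear_degree s i then r i else 0%N.
Proof.
move=> II Ih s_gt0 [P [rP dP]].
by rewrite (betti_tor_dim II Ih P) (linear_resolution_tor _ _ s_gt0 rP dP).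
Qed.

Lemma total_betti_linear I s r i : is_ideal I -> homog_closed I ->
    (0 < s)%N -> has_linear_resolution I s r ->
  total_betti I i = betti I i (linear_degree s i).
Proof.
move=> II Ih s_gt0 Ires; rewrite /total_betti.
rewrite -(@fsbig_widen _ _ _ _ [set linear_degree s i]%classic) ?fsbig_set1 //.
move=> j [_ /= ne]; rewrite (linear_resolution_betti _ _ II Ih s_gt0 Ires).
by case: eqP.
Qed.

End LinearResolutions.

(** * Linear quotients *)

Section LinearQuotients.

Variables (F : fieldType) (n : nat).
Local Notation S := {mpoly F[n]}.
Implicit Types (A B C V W : {set 'I_n}) (L : seq ({set 'I_n} * {set 'I_n})).

(* A pair (B, V) stands for the generator x^B together with the set V of
   variables that generates the colon ideal of the generators further down the
   list by x^B. *)
Fixpoint linear_quotients L : Prop :=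
  if L is (B, V) :: L' then
    [/\ forall C, C \in unzip1 L' -> V :&: (C :\: B) != set0,
        forall v, v \in V -> exists2 C, C \in unzip1 L' & C :\: B = [set v]
      & linear_quotients L']
  else True.

Definition contains_some L : pred {set 'I_n} :=
  fun A => has (fun B => B \subset A) (unzip1 L).

(* The support_ideal of meets_all L is the Stanley-Reisner ideal of the complex
   generated by the complements of the sets B, the Alexander dual of the complex
   with ideal contains_some L. *)
Definition meets_all L : pred {set 'I_n} :=
  fun A => all (fun B => B :&: A != set0) (unzip1 L).

Definition meets W : pred {set 'I_n} := fun A => W :&: A != set0.

Lemma meetsP W A : reflect (exists2 v, v \in W & v \in A) (meets W A).
Proof.
apply: (iffP (set0Pn _)) => [[v /setIP[]]|[v vW vA]]; first by exists v.
by exists v; rewrite inE vW.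
Qed.

Lemma meets_up W : up_closed (meets W).
Proof. by move=> A B sAB; apply: subset_neq0; apply: setIS. Qed.

Lemma contains_some_up L : up_closed (contains_some L).
Proof.
move=> A B sAB /hasP[C CL sCA]; apply/hasP; exists C => //.
exact: fintype.subset_trans sAB.
Qed.

Lemma meets_all_up L : up_closed (meets_all L).
Proof. by move=> A B sAB /allP mA; apply/allP => C /mA; apply: meets_up. Qed.

Lemma meetsU1 W v : meets (v |: W) =1 fun A => meets W A || ([set v] \subset A).
Proof.
move=> A; rewrite sub1set; apply/meetsP/orP => [[u /setU1P[->|uW] uA]|[|vA]].
- by right.
- by left; apply/meetsP; exists u.
- by case/meetsP => u uW uA; exists u; rewrite // inE uW orbT.
- by exists v; rewrite ?setU11.
Qed.

Lemma meets_setU1 W v A : v \notin W -> meets W (A :|: [set v]) = meets W A.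
Proof.
move=> vW; apply/meetsP/meetsP => -[u uW uA]; exists u => //; last by rewrite inE uA.
by move: uA vW; rewrite !inE => /orP[//|/eqP <-]; rewrite uW.
Qed.

Lemma contains_some_cons B V L :
  contains_some ((B, V) :: L) =1 fun A => contains_some L A || (B \subset A).
Proof. by move=> A; rewrite orbC. Qed.

Lemma contains_some_colon B V L : linear_quotients ((B, V) :: L) ->
  (fun A => contains_some L (A :|: B)) =1 meets V.
Proof.
case=> VC VE _ A; apply/hasP/meetsP => [[C CL sCAB]|[v vV vA]].
  have /set0Pn[v] := VC C CL; rewrite !inE => /and3P[vV vB vC]; exists v => //.
  by have := fintype.subsetP sCAB v vC; rewrite inE (negPf vB) orbF.
have [C CL CE] := VE v vV; exists C => //.
by rewrite setUC -subDset CE sub1set.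
Qed.

Lemma meets_all_colon B V L : linear_quotients ((B, V) :: L) ->
  (fun A => meets_all ((B, V) :: L) (A :|: V)) =1 meets B.
Proof.
case=> VC VE _ A; rewrite /meets_all /=.
have -> : all (fun C => C :&: (A :|: V) != set0) (unzip1 L).
  apply/allP => C /VC /set0Pn[v]; rewrite !inE => /and3P[vV _ vC].
  by apply/set0Pn; exists v; rewrite !inE vC vV orbT.
rewrite andbT; apply/meetsP/meetsP => -[v vB vA]; exists v => //.
  move: vA; rewrite inE => /orP[//|/VE [C _ CE]].
  by have := set11 v; rewrite -CE inE vB.
by rewrite inE vA.
Qed.

Lemma meets_all_tail B V L : linear_quotients ((B, V) :: L) ->
  (fun A => meets_all ((B, V) :: L) A || (V \subset A)) =1 meets_all L.
Proof.
case=> VC VE _ A; rewrite /meets_all /=.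
have [BA|BA] := boolP (B :&: A != set0) => /=.
  apply/orP/idP => [[//|sVA]|->]; last by left.
  apply/allP => C /VC /set0Pn[v]; rewrite !inE => /and3P[vV _ vC].
  by apply/set0Pn; exists v; rewrite inE vC (fintype.subsetP sVA).
apply/idP/allP => [sVA C /VC /set0Pn[v]|AL].
  rewrite !inE => /and3P[vV _ vC].
  by apply/set0Pn; exists v; rewrite inE vC (fintype.subsetP sVA).
apply/fintype.subsetP => v /VE [C CL CE]; have /set0Pn[u /setIP[uC uA]] := AL C CL.
have : u \in C :\: B.
  rewrite inE uC andbT; apply: contra BA => uB.
  by apply/set0Pn; exists u; rewrite inE uB.
by rewrite CE inE => /eqP <-.
Qed.

Lemma variable_ideal_resolution W :
  has_linear_resolution (support_ideal (F := F) (meets W)) 1 (fun i => 'C(#|W|, i)).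
Proof.
elim: {W}#|W| {-2}W (erefl #|W|) => [|k IHk] W Wk.
  have -> : W = set0 by apply: cards0_eq.
  rewrite (@eq_support_ideal F _ _ pred0) => [|A]; last first.
    by apply/negbTE/negP => /meetsP[v]; rewrite inE.
  apply: (eq_linear_resolution (zero_ideal_resolution _ _ _)) => -[|i] /=;
    by rewrite cards0 ?bin0.
have /card_gt0P[v vW] : (0 < #|W|)%N by rewrite Wk.
have W'k : #|W :\ v| = k by apply/eqP; rewrite -eqSS -Wk (cardsD1 v W) vW.
have vW' : v \notin W :\ v by rewrite !inE eqxx.
rewrite Wk -(setD1K vW) (eq_support_ideal F (meetsU1 _ _)).
rewrite -(adjoin_support _ _ (@meets_up _)).
have fh := setmon_homog F [set v]; rewrite cards1 in fh.
have := cone_linear_resolution (support_ideal_ideal F (@meets_up (W :\ v)))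
  (@support_ideal_homog _ _ _) fh _ (IHk _ W'k)
  (IHk _ W'k).
rewrite W'k => /(_ _)[|P PE]; last first.
  apply: (eq_linear_resolution (ex_intro _ P PE)) => -[|i] /=.
    by rewrite !bin0.
  by rewrite binS.
move=> p; rewrite support_ideal_colon.
by rewrite (@eq_support_ideal F _ (fun B => _ (B :|: _)) (meets (W :\ v))) // => A;
  rewrite meets_setU1.
Qed.

Lemma linear_quotients_resolution L s : linear_quotients L ->
    (forall B, B \in unzip1 L -> #|B| = s) ->
  has_linear_resolution (support_ideal (F := F) (contains_some L)) s
    (fun i => if i is i'.+1 then \sum_(V <- unzip2 L) 'C(#|V|, i') else 1)%N.
Proof.
elim: L => [|[B V] L IHL] Llq Ls.
  rewrite (@eq_support_ideal F _ (contains_some [::]) pred0) //.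
  apply: (eq_linear_resolution (zero_ideal_resolution _ _ _)) => -[|i] //=.
  by rewrite big_nil.
have {}IHL := IHL (let: And3 _ _ h := Llq in h)
  (fun C CL => Ls C (mem_behead (s := unzip1 ((B, V) :: L)) CL)).
rewrite (eq_support_ideal F (contains_some_cons B V L)).
rewrite -(adjoin_support _ _ (@contains_some_up _)).
have fh := setmon_homog F B; rewrite (Ls B) ?mem_head // in fh.
have := cone_linear_resolution (support_ideal_ideal F (@contains_some_up L))
  (@support_ideal_homog _ _ _) fh _ IHL (variable_ideal_resolution V).
move=> /(_ _)[p|P PE].
  by rewrite support_ideal_colon (eq_support_ideal F (contains_some_colon Llq)).
apply: (eq_linear_resolution (ex_intro _ P PE)) => -[|i] //=.
by rewrite big_cons addnC.
Qed.

End LinearQuotients.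

(** * Regular sequences *)

Section RegularSequences.

Variables (F : fieldType) (n : nat).
Local Notation S := {mpoly F[n]}.
Implicit Types (J K : set S) (f p q t : S) (theta : seq S).

Definition nonzerodivisor_mod J t : Prop := forall p, J (t * p) -> J p.

Fixpoint weakly_regular J theta : Prop :=
  if theta is t :: theta' then
    nonzerodivisor_mod J t /\ weakly_regular (adjoin J t) theta'
  else True.

Definition adjoin_seq J theta : set S := foldl (@adjoin F n) J theta.

Lemma adjoin_seq_ideal J theta : is_ideal J -> is_ideal (adjoin_seq J theta).
Proof.
by elim: theta J => //= t theta IH J JI; apply/IH/adjoin_ideal.
Qed.

Lemma sub_adjoin_seq J theta p : J p -> adjoin_seq J theta p.
Proof. by elim: theta J => //= t theta IH J Jp; apply/IH/sub_adjoin. Qed.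

Lemma adjoin_seq_sub J K theta : is_ideal K -> (J `<=` K)%classic ->
  (forall t, t \in theta -> K t) -> (adjoin_seq J theta `<=` K)%classic.
Proof.
move=> KI; elim: theta J => //= t theta IH J JK thK.
apply: IH => [p [q /JK Kp]|u uth].
  rewrite -[p](subrK (q * t)); apply: is_idealD => //.
  by apply: is_idealM => //; apply: thK; rewrite mem_head.
by apply: thK; rewrite inE uth orbT.
Qed.

Lemma adjoin_seq_rcons J theta t :
  adjoin_seq J (rcons theta t) = adjoin (adjoin_seq J theta) t.
Proof. exact: foldl_rcons. Qed.

Lemma weakly_regular_rcons J theta t :
  weakly_regular J (rcons theta t) <->
  weakly_regular J theta /\ nonzerodivisor_mod (adjoin_seq J theta) t.
Proof.
elim: theta J => [|t' theta IH] J /=; first by split=> [[] | []].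
by rewrite IH /=; tauto.
Qed.

Lemma weakly_regular_top J theta : is_ideal J -> J 1 -> weakly_regular J theta.
Proof.
move=> JI J1; elim: theta J JI J1 => //= t theta IH J JI J1; split.
  by move=> p _; rewrite -[p]mulr1; apply: is_idealM.
by apply: IH; [exact: adjoin_ideal | exact: sub_adjoin].
Qed.

Lemma weakly_regular_extension J K f theta : is_ideal J ->
    (forall p, K p <-> J (p * f)) ->
    weakly_regular K theta -> weakly_regular (adjoin J f) theta ->
  weakly_regular J theta.
Proof.
elim: theta J K => //= t theta IH J K JI JK [Kt Kth] [Jft Jfth]; split.
  move=> p Jtp; have [q Jpq] := Jft p (sub_adjoin f Jtp).
  have Jq : J (q * f).
    apply/JK/Kt/JK.
    have -> : t * q * f = t * p - t * (p - q * f) by ring.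
    by apply: is_idealB => //; apply: is_idealM.
  by rewrite -[p](subrK (q * f)); apply: is_idealD.
apply: (IH _ (adjoin K t)) => //; last by rewrite adjoinC.
  exact: adjoin_ideal.
move=> p; split=> [[q /JK Jpq]|[q Jpq]].
  by exists (q * f); rewrite mulrBl in Jpq; rewrite mulrAC.
have [q' Jq'] : adjoin J f q.
  apply: Jft; exists p.
  have -> : t * q - p * f = - (p * f - q * t) by ring.
  exact: is_idealN.
exists q'; apply/JK.
have -> : (p - q' * t) * f = (p * f - q * t) + t * (q - q' * f) by ring.
by apply: is_idealD => //; apply: is_idealM.
Qed.

Lemma nonzerodivisor_swap J t (v : 'I_n) d : is_ideal J -> homog_closed J ->
    t \is d.-homog -> nonzerodivisor_mod J 'X_v ->
    nonzerodivisor_mod (adjoin J 'X_v) t ->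
  nonzerodivisor_mod J t /\ nonzerodivisor_mod (adjoin J t) 'X_v.
Proof.
move=> JI Jh th Jv Jvt; have vh : ('X_v : S) \is 1.-homog.
  by rewrite dhomogX; apply/eqP/mdeg1.
have part e p : J (t * p) -> J (pihomog mdeg e p).
  elim: e p => [|e IHe] p Jtp.
    have [q /(Jh 0%N)] := Jvt p (sub_adjoin _ Jtp).
    by rewrite pihomogB (pihomogM_lt _ vh) // subr0.
  have Jtpe : J (t * pihomog mdeg e.+1 p).
    by rewrite mulrC -(pihomogM _ _ th) mulrC; apply: Jh.
  have [q] := Jvt _ (sub_adjoin _ Jtpe); move/(Jh e.+1).
  rewrite pihomogB pihomog_id -addn1 (pihomogM _ _ vh) addn1 => Jpq.
  suff Jq : J (pihomog mdeg e q).
    rewrite -[pihomog mdeg _ p](subrK (pihomog mdeg e q * 'X_v)).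
    by apply: is_idealD => //; apply: is_idealMr.
  rewrite -pihomog_id; apply/IHe/Jv.
  have -> : 'X_v * (t * pihomog mdeg e q) = t * pihomog mdeg e.+1 p -
     t * (pihomog mdeg e.+1 p - pihomog mdeg e q * 'X_v) by ring.
  by apply: is_idealB => //; apply: is_idealM.
split=> [p Jtp|p [q Jpq]].
  rewrite (pihomog_partitionE (leqnn (msize p))).
  by apply: is_ideal_sum => // e _; apply: part.
have [r Jqr] : adjoin J 'X_v q.
  apply: Jvt; exists p.
  have -> : t * q - p * 'X_v = - ('X_v * p - q * t) by ring.
  exact: is_idealN.
exists r; apply: Jv.
have -> : 'X_v * (p - r * t) = ('X_v * p - q * t) + t * (q - r * 'X_v) by ring.
by apply: is_idealD => //; apply: is_idealM.
Qed.

Lemma weakly_regular_swap J theta (v : 'I_n) : is_ideal J -> homog_closed J ->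
    (forall t, t \in theta -> exists d, t \is d.-homog) ->
    nonzerodivisor_mod J 'X_v -> weakly_regular (adjoin J 'X_v) theta ->
  weakly_regular J theta /\ nonzerodivisor_mod (adjoin_seq J theta) 'X_v.
Proof.
elim: theta J => //= t theta IH J JI Jh thetah Jv [Jvt Jvth].
have [d th] := thetah t (mem_head _ _).
have [Jt Jtv] := nonzerodivisor_swap JI Jh th Jv Jvt.
have [||u uth||Jth Jthv] := IH (adjoin J t) _ _ _ Jtv.
- exact: adjoin_ideal.
- exact: adjoin_homog th.
- by apply: thetah; rewrite inE uth orbT.
- by rewrite adjoinC.
by split.
Qed.

Definition elementary_symmetric_seq m : seq S :=
  [seq mesym n F i.+1 | i <- iota 0 m].

Lemma elementary_symmetric_seq_homog m t : t \in elementary_symmetric_seq m ->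
  exists d, t \is d.-homog.
Proof. by case/mapP => i _ ->; exists i.+1; apply: dhomog_mesym. Qed.

Lemma nonzerodivisor_prod J (r : seq 'I_n) : is_ideal J ->
    (forall v, v \in r -> nonzerodivisor_mod J 'X_v) ->
  nonzerodivisor_mod J (\prod_(v <- r) 'X_v).
Proof.
move=> JI; elim: r => [|v r IH] Jr p; first by rewrite big_nil mul1r.
rewrite big_cons -mulrA => /(Jr v (mem_head _ _)); apply: IH => u ur.
by apply: Jr; rewrite inE ur orbT.
Qed.

(* Modulo the variables in W, the last elementary symmetric polynomial is the
   product of the remaining variables. *)
Lemma mesym_mod_variables (W : {set 'I_n}) :
  support_ideal (meets W) (mesym n F #|~: W| - setmon F (~: W)).
Proof.
rewrite /mesym (bigD1 (~: W)) //= -setmon_prod addrAC subrr add0r.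
apply: is_ideal_sum => [|h /andP[/eqP hW neh]].
  exact/support_ideal_ideal/meets_up.
rewrite -setmon_prod; apply/support_idealX; rewrite mnm_supp_ind.
apply: contraR neh; rewrite negbK setI_eq0 disjoint_sym disjoints_subset => sh.
by rewrite eqEcard sh hW leqnn.
Qed.

Lemma weakly_regular_variables (W : {set 'I_n}) :
  weakly_regular (support_ideal (meets W)) (elementary_symmetric_seq #|~: W|).
Proof.
elim: {W}#|~: W| {-2}W (erefl #|~: W|) => [|m IHm] W Wm; first by rewrite Wm.
have PI (V : {set 'I_n}) := support_ideal_ideal F (@meets_up _ V).
have Pswap v : v \in ~: W ->
  weakly_regular (support_ideal (F := F) (meets W)) (elementary_symmetric_seq m) /\
  nonzerodivisor_mod (adjoin_seq (support_ideal (meets W))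
    (elementary_symmetric_seq m)) 'X_v.
  rewrite inE => vW; have Xv : 'X_v = setmon F [set v].
    by rewrite setmon_prod big_set1.
  apply: weakly_regular_swap => //.
  - exact: support_ideal_homog.
  - exact: elementary_symmetric_seq_homog.
  - move=> p; rewrite Xv mulrC support_ideal_colon.
    by rewrite (@eq_support_ideal F _ (fun B => _ (B :|: _)) (meets W)) // => A;
      rewrite meets_setU1.
  - rewrite Xv (adjoin_support _ _ (@meets_up _ _)).
    rewrite -(eq_support_ideal F (meetsU1 W v)).
    have W'm : #|~: (v |: W)| = m.
      have -> : ~: (v |: W) = (~: W) :\ v by rewrite setCU setIC setDE.
      by apply/eqP; rewrite -eqSS -Wm (cardsD1 v (~: W)) inE vW.
    by rewrite -W'm; apply: IHm.
have /card_gt0P[v0 v0W] : (0 < #|~: W|)%N by rewrite Wm.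
have [Wreg _] := Pswap v0 v0W.
rewrite Wm /elementary_symmetric_seq -[m.+1]addn1 iotaD map_cat cats1 add0n.
apply/weakly_regular_rcons; split=> //.
set K := adjoin_seq _ _; have KI : is_ideal K by apply: adjoin_seq_ideal.
have Kprod : nonzerodivisor_mod K (setmon F (~: W)).
  rewrite setmon_prod -big_enum; apply: nonzerodivisor_prod => // v.
  by rewrite mem_enum => /Pswap [].
move=> p Kp; apply: Kprod.
have -> : setmon F (~: W) * p =
    mesym n F m.+1 * p - p * (mesym n F m.+1 - setmon F (~: W)) by ring.
apply: is_idealB => //; apply: is_idealM => //; apply: sub_adjoin_seq.
by rewrite -Wm; apply: mesym_mod_variables.
Qed.

Lemma weakly_regular_shelling (L : seq ({set 'I_n} * {set 'I_n})) s :
    linear_quotients L -> (forall B, B \in unzip1 L -> #|B| = s) ->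
  weakly_regular (support_ideal (meets_all L)) (elementary_symmetric_seq (n - s)).
Proof.
elim: L => [|[B V] L IHL] Llq Ls.
  apply: weakly_regular_top; first exact/support_ideal_ideal/meets_all_up.
  by move=> m.
apply: (@weakly_regular_extension _ (support_ideal (meets B)) (setmon F V)).
- exact/support_ideal_ideal/meets_all_up.
- move=> p; rewrite support_ideal_colon.
  by rewrite (eq_support_ideal F (meets_all_colon Llq)).
- have <- : #|~: B| = (n - s)%N by rewrite cardsCs setCK card_ord Ls ?mem_head.
  exact: weakly_regular_variables.
rewrite (adjoin_support _ _ (@meets_all_up _ _)).
rewrite (eq_support_ideal F (meets_all_tail Llq)); apply: IHL.
  by case: Llq.
by move=> C CL; apply: Ls; rewrite inE CL orbT.
Qed.

Lemma partial_idealE J theta k : is_ideal J ->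
  partial_ideal J theta k = adjoin_seq J (take k theta).
Proof.
move=> JI; rewrite /partial_ideal; move: (take k theta) => {theta k} theta.
apply/seteqP; split.
  apply: sub_ideal_gen; first exact: adjoin_seq_ideal.
  move=> p [Jp|/=]; first exact: sub_adjoin_seq.
  elim: theta J JI => //= t theta IH J JI; rewrite inE => /orP[/eqP ->|pth].
    by apply: sub_adjoin_seq; have := mem_adjoin t 1 JI; rewrite mul1r.
  exact/IH/pth/adjoin_ideal.
apply: adjoin_seq_sub; first exact: ideal_gen_ideal.
  by move=> p Jp; apply: mem_ideal_gen; left.
by move=> t tth; apply: mem_ideal_gen; right.
Qed.

Lemma weakly_regular_nth J theta : weakly_regular J theta <->
  forall k, (k < size theta)%N ->
    nonzerodivisor_mod (adjoin_seq J (take k theta)) theta`_k.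
Proof.
elim: theta J => [|t theta IH] J //=; rewrite IH; split=> [[Jt Jth] [|k] //=|Jth].
  exact: Jth.
by split=> [|k kth]; [exact: (Jth 0%N) | exact: (Jth k.+1)].
Qed.

Lemma regular_sequenceE J theta : is_ideal J ->
  regular_sequence J theta <->
  [/\ forall k, (k < size theta)%N -> exists2 d, (0 < d)%N & theta`_k \is d.-homog,
      weakly_regular J theta & ~ adjoin_seq J theta 1].
Proof.
move=> JI; have E k := partial_idealE theta k JI.
split=> -[h r p1]; split=> //.
- by apply/weakly_regular_nth => k kth p; rewrite -E; apply: r.
- by rewrite -[theta]take_size -E.
- by move=> k kth p; rewrite E; apply: (proj1 (weakly_regular_nth _ _) r).
- by rewrite E take_size.
Qed.

End RegularSequences.

(** * Bounding chains by counting *)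

Section DimensionBound.

Variables (F : fieldType) (n : nat).
Local Notation S := {mpoly F[n]}.
Implicit Types (A B : set S) (f p q : S).

Definition independent_mod A (T : finType) (b : T -> S) : Prop :=
  forall c : T -> F, A (\sum_t c t *: b t) -> forall t, c t = 0.

Lemma independent_mod_powers A B f (T : finType) (b : T -> S) K :
    is_ideal A -> is_ideal B -> (A `<=` B)%classic -> B f ->
    nonzerodivisor_mod A f -> independent_mod B b ->
  independent_mod A (fun kt : 'I_K * T => f ^+ kt.1 * b kt.2).
Proof.
move=> AI BI sAB Bf Af Bb.
have main (c : nat -> T -> F) :
    A (\sum_(k < K) f ^+ k * (\sum_t c k t *: b t)) ->
    forall k t, (k < K)%N -> c k t = 0.
  elim: K c => // K IHK c; rewrite big_ord_recl expr0 mul1r.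
  under [X in _ + X]eq_bigr => k _ do rewrite lift0 exprS -mulrA.
  rewrite -mulr_sumr => Ac.
  have c0 : forall t, c 0%N t = 0.
    apply: Bb; apply: (proj1 (is_ideal_eqmod BI _) (sAB _ Ac)).
    by rewrite addrC addKr; apply: is_idealMr.
  move: Ac; rewrite big1 => [|t _]; last by rewrite c0 scale0r.
  rewrite add0r => /Af /(IHK (fun k => c k.+1)) Ac [|k] t //.
  by rewrite ltnS; apply: Ac.
move=> c Ac [k t].
pose c' k t := oapp (fun k => c (k, t)) 0 (insub k : option 'I_K).
have c'E (k' : 'I_K) t' : c' k' t' = c (k', t') by rewrite /c' valK.
rewrite -c'E; apply: main (ltn_ord k).
congr (A _): Ac.
transitivity (\sum_(k < K) \sum_t c (k, t) *: (f ^+ k * b t)).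
  by rewrite pair_bigA; apply: eq_bigr => -[].
apply: eq_bigr => k' _; rewrite mulr_sumr; apply: eq_bigr => t' _.
by rewrite c'E scalerAr.
Qed.

Lemma msize_exp_mul f p k : (msize (f ^+ k * p) <= k * msize f + msize p)%N.
Proof.
elim: k => [|k IHk]; first by rewrite expr0 mul1r.
rewrite exprS -mulrA; set q := f ^+ k * p in IHk *.
have [->|f0] := eqVneq f 0; first by rewrite mul0r msize0.
have [->|q0] := eqVneq q 0; first by rewrite mulr0 msize0.
rewrite msizeM // mulSn -addnA; apply: leq_trans (leq_pred _) _.
by rewrite leq_add2l.
Qed.

Lemma independent_mod_chain r (A : nat -> set S) (f : nat -> S) :
    (forall k, (k <= r)%N -> is_ideal (A k)) -> ~ A r 1 ->
    (forall k, (k < r)%N -> [/\ (A k `<=` A k.+1)%classic, A k.+1 (f k)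
                              & nonzerodivisor_mod (A k) (f k)]) ->
  exists E, forall K, exists (T : finType) (b : T -> S),
    [/\ #|T| = (K ^ r)%N, forall t, (msize (b t) <= (K * E).+1)%N
      & independent_mod (A 0%N) b].
Proof.
elim: r A f => [|r IHr] A f AI A1 Af.
  exists 0%N => K; exists unit, (fun=> 1); split; rewrite ?card_unit //.
    by move=> _; rewrite msize1.
  move=> c; rewrite (big_pred1 tt) => [Ac [] | [] //].
  apply: contra_notP A1 => /eqP c0.
  rewrite -[1](scalerK c0) -mul_mpolyC; apply: is_idealM => //.
  exact: AI.
have [|k kr|E HE] := IHr (A \o succn) (f \o succn) _ A1.
- by move=> k kr; apply: AI.
- exact: Af.
exists (msize (f 0%N) + E)%N => K; have [T [b [cT db ib]]] := HE K.
exists ('I_K * T)%type, (fun kt : 'I_K * T => f 0%N ^+ kt.1 * b kt.2).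
have [sA01 A1f A0f] := Af 0%N isT.
split; first by rewrite card_prod card_ord cT expnS.
  move=> [k t] /=; apply: leq_trans (msize_exp_mul _ _ _) _.
  rewrite mulnDr -addnS leq_add // leq_mul2r ltnW ?orbT //.
by apply: independent_mod_powers A1f A0f ib => //; apply: AI.
Qed.

Lemma card_bounded_support d N (U : pred {set 'I_n}) :
    (forall C, ~~ U C -> (#|C| <= d)%N) ->
  (#|[set g : {ffun 'I_n -> 'I_N.+1} | ~~ U [set i | g i != ord0]]|
     <= 2 ^ n * N.+1 ^ d)%N.
Proof.
move=> Ud; set Z := [set g | _].
rewrite -sum1_card.
rewrite (partition_big (fun g : {ffun 'I_n -> 'I_N.+1} => [set i | g i != ord0])
   predT) //=.
apply: (@leq_trans (\sum_(C : {set 'I_n}) N.+1 ^ d)); last first.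
  by rewrite sum_nat_const -cardsT -powersetT card_powerset cardsT card_ord.
apply: leq_sum => C _; rewrite sum1dep_card.
have [UC|UC] := boolP (U C).
  rewrite (_ : [set g | _] = set0) ?cards0 //; apply/setP => g; rewrite !inE.
  by apply/negbTE/negP => /andP[Ug /eqP gC]; rewrite gC UC in Ug.
apply: (@leq_trans (N.+1 ^ #|C|)); last by rewrite leq_pexp2l // Ud.
have <- : #|pffun_on (ord0 : 'I_N.+1) C predT| = (N.+1 ^ #|C|)%N.
  by rewrite card_pffun_on card_ord.
apply: subset_leq_card; apply/subsetP => g; rewrite !inE => /andP[_ /eqP gC].
by apply/pffun_onP; split=> //; apply/subsetP => i; rewrite -gC !inE.
Qed.

Lemma independent_mod_support (U : pred {set 'I_n}) d N (T : finType) (b : T -> S) :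
    (forall C, ~~ U C -> (#|C| <= d)%N) -> (forall t, (msize (b t) <= N.+1)%N) ->
    independent_mod (support_ideal U) b ->
  (#|T| <= 2 ^ n * N.+1 ^ d)%N.
Proof.
move=> Ud bN bU; apply: leq_trans (card_bounded_support N Ud).
set Z := [set g | _].
pose mon (g : {ffun 'I_n -> 'I_N.+1}) := [multinom g i : nat | i < n].
pose M : 'M[F]_(#|T|, #|Z|) := \matrix_(t, g) (b (enum_val t))@_(mon (enum_val g)).
suff /eqP <- : row_free M by apply: rank_leq_col.
apply: inj_row_free => v vM; apply/rowP => t; rewrite [RHS]mxE -[t]enum_valK.
pose c t' := v 0 (enum_rank t'); rewrite -/(c _); apply: bU => m.
rewrite mcoeff_msupp; apply: contraR => Um; apply/eqP.
have [big|small] := boolP [exists i, (N < m i)%N].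
  case/existsP: big => i Ni; rewrite raddf_sum big1 //= => t' _.
  rewrite mcoeffZ memN_msupp_eq0 ?mulr0 //; apply/negP => /msize_mdeg_lt.
  rewrite ltnNge => /negP; apply; apply: leq_trans (bN t') _.
  by apply: leq_trans Ni _; rewrite mdegE (bigD1 i) //= leq_addr.
have mN i : (m i < N.+1)%N.
  by rewrite ltnS leqNgt; apply: contra small => Ni; apply/existsP; exists i.
pose g := [ffun i => Ordinal (mN i)].
have gm : mon g = m by apply/mnmP => i; rewrite mnmE ffunE.
have gZ : g \in Z.
  rewrite inE; congr (~~ U _): Um; apply/setP => i.
  by rewrite !inE -(inj_eq val_inj) ffunE.
move/rowP/(_ (enum_rank_in gZ g)): vM; rewrite !mxE => vMg.
rewrite -[RHS]vMg raddf_sum (reindex (@enum_val T predT)) /=; last first.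
  exact/onW_bij/enum_val_bij.
by apply: eq_bigr => k _; rewrite mcoeffZ mxE enum_rankK_in // gm /c enum_valK.
Qed.

Lemma chain_length_bound (U : pred {set 'I_n}) d r (A : nat -> set S)
    (f : nat -> S) :
    (forall C, ~~ U C -> (#|C| <= d)%N) -> (support_ideal U `<=` A 0%N)%classic ->
    (forall k, (k <= r)%N -> is_ideal (A k)) -> ~ A r 1 ->
    (forall k, (k < r)%N -> [/\ (A k `<=` A k.+1)%classic, A k.+1 (f k)
                              & nonzerodivisor_mod (A k) (f k)]) ->
  (r <= d)%N.
Proof.
move=> Ud sUA AI A1 Af; have [E HE] := independent_mod_chain AI A1 Af.
rewrite leqNgt; apply/negP => lt_dr.
pose K := (2 ^ n * E.+1 ^ d).+1; have [T [b [cT db ib]]] := HE K.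
have := @independent_mod_support U d (K * E) T b Ud db (fun c Uc => ib c (sUA _ Uc)).
rewrite cT; apply/negP; rewrite -ltnNge.
apply: (@leq_trans (K ^ d.+1)); last by rewrite leq_pexp2l.
apply: (@leq_ltn_trans (2 ^ n * (K * E.+1) ^ d)).
  rewrite leq_mul2l; apply/orP; right; case: (d) => // d'.
  by rewrite leq_exp2r // mulnS -add1n leq_add2r.
rewrite expnMn mulnCA expnS mulnC ltn_pmul2r ?expn_gt0 //.
Qed.

End DimensionBound.

(** * Cohen-Macaulayness *)

Section CohenMacaulay.

Variables (F : fieldType) (n : nat).
Local Notation S := {mpoly F[n]}.
Implicit Types (p q : S) (W : {set 'I_n}).

Definition kill_vars W : n.-tuple S := [tuple if i \in W then 0 else 'X_i | i < n].

Lemma kill_varsX W m :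
  'X_[m] \mPo kill_vars W = if meets W (mnm_supp m) then 0 else 'X_[m] :> S.
Proof.
rewrite comp_mpolyX; case: meetsP => [[v vW vm]|Wm].
  rewrite inE in vm.
  by rewrite (bigD1 v) //= tnth_mktuple vW expr0n (negPf vm) mul0r.
rewrite [RHS]mpolyXE_id; apply: eq_bigr => i _; rewrite tnth_mktuple.
case: ifP => // iW; have [->|im] := eqVneq (m i) 0%N; first by rewrite !expr0.
by case: Wm; exists i; rewrite // inE.
Qed.

Lemma kill_vars_eq0 W p :
  p \mPo kill_vars W = 0 <-> support_ideal (meets W) p.
Proof.
have WI := support_ideal_ideal F (@meets_up _ W); split=> [p0|Wp].
  rewrite -[p]subr0 -p0 [X in X - _]mpolyE [X in _ - (X \mPo _)]mpolyE.
  rewrite (raddf_sum (comp_mpoly (kill_vars W))) -sumrB.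
  apply: is_ideal_sum => // m _ /=; rewrite comp_mpolyZ -scalerBr -mul_mpolyC.
  apply: (is_idealM _ WI); rewrite kill_varsX; case: ifP => Wm.
    by rewrite subr0; apply/support_idealX.
  by rewrite subrr; apply: is_ideal0.
rewrite [p]mpolyE (raddf_sum (comp_mpoly (kill_vars W))) big_seq big1 //=.
move=> m /Wp Wm.
by rewrite comp_mpolyZ kill_varsX Wm scaler0.
Qed.

Definition variable_prime W : {pred S} := fun p => p \mPo kill_vars W == 0.

Lemma variable_primeE W : [set` variable_prime W]%classic = support_ideal (meets W).
Proof.
apply/seteqP; split=> p /=; first by move/eqP/kill_vars_eq0.
by move/kill_vars_eq0/eqP.
Qed.

Lemma variable_prime_closed W :
  idealr_closed (variable_prime W) /\ prime_idealr_closed (variable_prime W).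
Proof.
split; last first.
  move=> p q; rewrite !unfold_in rmorphM /= mulf_eq0.
  by case/orP => ->; rewrite ?orbT.
split; rewrite ?unfold_in ?comp_mpoly0 ?comp_mpoly1 ?oner_eq0 //.
move=> a p q; rewrite !unfold_in rmorphD rmorphM /= => /eqP -> /eqP ->.
by rewrite mulr0 addr0.
Qed.

Lemma prime_chain_bound (U : pred {set 'I_n}) d r :
    (forall C, ~~ U C -> (#|C| <= d)%N) ->
  prime_chain (support_ideal (F := F) U) r -> (r <= d)%N.
Proof.
move=> Ud [P [PP Plt]].
have /choice [f Pf] k : exists p, (k < r)%N -> p \in P k.+1 /\ p \notin P k.
  have [kr|_] := boolP (k < r)%N; last by exists 0.
  have [_ /existsNP [p /not_implyP [Pp /negP nPp]]] := Plt k kr.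
  by exists p.
apply: (@chain_length_bound _ _ U d r (fun k => [set` P k]%classic) f) => //.
- by have [] := PP 0%N isT.
- move=> k /PP [[P0 _ PL] _ _]; split=> // a p q; exact: PL.
- by have [[_ /negP P1 _] _ _] := PP r (leqnn r).
move=> k kr; have [P1 P0] := Pf k kr; split=> //; first by case: (Plt k kr).
move=> p /=; have [_ Pprime _] := PP k (ltnW kr).
by move/Pprime => /orP[|//]; rewrite (negPf P0).
Qed.

Lemma regular_sequence_bound (U : pred {set 'I_n}) d (theta : seq S) :
    up_closed U -> (forall C, ~~ U C -> (#|C| <= d)%N) ->
  regular_sequence (support_ideal U) theta -> (size theta <= d)%N.
Proof.
move=> Uup Ud; have UI := support_ideal_ideal F Uup.
case/(regular_sequenceE _ UI) => _ /weakly_regular_nth thr th1.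
apply: (@chain_length_bound _ _ U d _
  (fun k => adjoin_seq (support_ideal U) (take k theta)) (fun k => theta`_k)) => //.
- by rewrite take0.
- by move=> k _; apply: adjoin_seq_ideal.
- by rewrite take_size.
move=> k kth; rewrite (take_nth 0 kth) adjoin_seq_rcons; split.
- by move=> p; apply: sub_adjoin.
- have := mem_adjoin theta`_k 1 (adjoin_seq_ideal (take k theta) UI).
  by rewrite mul1r.
- exact: thr.
Qed.

Lemma variable_prime_chain (U : pred {set 'I_n}) (C : {set 'I_n}) :
    up_closed U -> ~~ U C ->
  prime_chain (support_ideal (F := F) U) #|C|.
Proof.
move=> Uup UC; pose W k := ~: C :|: [set v in take k (enum C)].
exists (fun k => variable_prime (W k)); split=> k kC.
  have [Pi Pp] := variable_prime_closed (W k); split=> //.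
  rewrite variable_primeE => p Up m /Up; apply: contraTT => Wm.
  apply: contra UC; apply: Uup; apply/subsetP => v vm.
  by apply: contraR Wm => vC; apply/meetsP; exists v; rewrite // !inE vC.
have kC' : (k < size (enum C))%N by rewrite -cardE.
have /card_gt0P [v0 _] : (0 < #|C|)%N by apply: leq_ltn_trans kC.
pose v := nth v0 (enum C) k.
have vW1 : v \in W k.+1.
  by rewrite !inE (take_nth v0) // mem_rcons mem_head orbT.
have vW0 : v \notin W k.
  rewrite !inE negb_or negbK -mem_enum mem_nth //=.
  have := enum_uniq C; rewrite -{1}(cat_take_drop k.+1 (enum C)) (take_nth v0) //.
  by rewrite cat_uniq rcons_uniq => /andP[/andP[]].
split.
  rewrite !variable_primeE => p Wp m /Wp /meetsP [u uW um].
  apply/meetsP; exists u => //; move: uW; rewrite !inE => /orP[->//|uk].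
  by rewrite (take_nth v0) // mem_rcons inE uk !orbT.
rewrite !variable_primeE => /(_ 'X_v) Wv.
have suppv : mnm_supp U_(v) = [set v].
  by apply/setP => i; rewrite !inE mnm1E eqb0 negbK eq_sym.
have /Wv /support_idealX : support_ideal (meets (W k.+1)) ('X_v : S).
  by apply/support_idealX; rewrite suppv; apply/meetsP; exists v; rewrite ?set11.
by rewrite suppv => /meetsP [u uW /set1P uv]; rewrite uv (negPf vW0) in uW.
Qed.

Lemma linear_quotients_cohen_macaulay (L : seq ({set 'I_n} * {set 'I_n})) s :
    linear_quotients L -> (forall B, B \in unzip1 L -> #|B| = s) ->
    (0 < size L)%N ->
  cohen_macaulay (support_ideal (F := F) (meets_all L)).
Proof.
move=> Llq Ls L0; pose U := meets_all L.
have Uup : up_closed U by apply: meets_all_up.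
have UI := support_ideal_ideal F Uup.
have Ud C : ~~ U C -> (#|C| <= n - s)%N.
  case/allPn => B BL; rewrite negbK setI_eq0 disjoint_sym disjoints_subset.
  move/subset_leq_card; rewrite [X in (_ <= X)%N]cardsCs setCK card_ord.
  by rewrite -(Ls B BL).
have [B BL] : exists B, B \in unzip1 L.
  by case: (L) L0 => [//|[B V] L' _]; exists B; rewrite mem_head.
have Bs : #|~: B| = (n - s)%N by rewrite cardsCs setCK card_ord Ls.
have UB : ~~ U (~: B) by apply/allPn; exists B; rewrite // setICr eqxx.
exists (n - s)%N; split.
- by rewrite -Bs; apply: variable_prime_chain.
- by move=> d'; apply: prime_chain_bound.
- exists (elementary_symmetric_seq F n (n - s)); last by rewrite size_map size_iota.
  apply/(regular_sequenceE _ UI); split.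
  + move=> k; rewrite size_map size_iota => kd; exists k.+1 => //.
    by rewrite (nth_map 0%N) ?size_iota // nth_iota // dhomog_mesym.
  + exact: weakly_regular_shelling.
  pose K0 : set S := support_ideal (fun A => A != set0).
  have K0I : is_ideal K0.
    by apply: support_ideal_ideal => A C sAC; apply: subset_neq0.
  suff sK0 : (adjoin_seq (support_ideal U)
      (elementary_symmetric_seq F n (n - s)) `<=` K0)%classic.
    move=> /sK0 /(_ 0%MM); rewrite msupp1 mem_head => /(_ isT) /set0Pn [v].
    by rewrite inE mnm0E.
  apply: adjoin_seq_sub => // [p Up m /Up /allP /(_ B BL)|t].
    by apply: contraNN => /eqP ->; rewrite setI0.
  case/mapP => i _ -> m /(dhomog_mf (dhomog_mesym _ _ _)) mi.
  apply: contraTneq isT => m0; have : mdeg m == 0%N.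
    rewrite mdegE sum_nat_eq0; apply/forallP => v /=.
    by have := in_set0 v; rewrite -m0 inE => /negbT; rewrite negbK.
  by rewrite mi.
- by move=> theta; apply: regular_sequence_bound.
Qed.

End CohenMacaulay.

(** * The square of a path *)

Section PathSquare.

Variable n : nat.
Implicit Types (A C : {set 'I_n}) (a b k : nat).

Definition ord_interval a b : {set 'I_n} := [set i : 'I_n | (a <= i < b)%N].

Definition ord_pair a b : {set 'I_n} :=
  [set i : 'I_n | (i == a :> nat) || (i == b :> nat)].

Lemma card_ord_interval a b : (a <= b)%N -> (b <= n)%N ->
  #|ord_interval a b| = (b - a)%N.
Proof.
move=> le_ab; elim: b le_ab => [|b IHb] le_ab lt_bn.
  by apply/eqP; rewrite cards_eq0; apply/eqP/setP => i; rewrite !inE; lia.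
have [->|ne_ab] := eqVneq a b.+1.
  rewrite subnn; apply/eqP; rewrite cards_eq0; apply/eqP/setP => i.
  by rewrite !inE; lia.
have -> : ord_interval a b.+1 = Ordinal lt_bn |: ord_interval a b.
  by apply/setP => i; rewrite !inE -(inj_eq val_inj) /=; lia.
by rewrite cardsU1 IHb ?inE /=; lia.
Qed.

Lemma card_ord_pair a b : (a < b)%N -> (b < n)%N -> #|ord_pair a b| = 2%N.
Proof.
move=> lt_ab lt_bn; have lt_an := ltn_trans lt_ab lt_bn.
have -> : ord_pair a b = [set Ordinal lt_an; Ordinal lt_bn].
  by apply/setP => i; rewrite !inE -!(inj_eq val_inj).
by rewrite cards2 -(inj_eq val_inj) /= neq_ltn lt_ab.
Qed.

Definition nonedge_gen a b : {set 'I_n} * {set 'I_n} :=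
  (ord_pair a b, ord_interval 0 a :|: ord_interval (a + 3) b).

Fixpoint nonedge_row b k :=
  if k is a.+1 then nonedge_gen a b :: nonedge_row b a else [::].

Fixpoint nonedge_gens b :=
  if b is b'.+1 then nonedge_row b' (b' - 2) ++ nonedge_gens b' else [::].

Lemma mem_nonedge_row b k C :
  C \in unzip1 (nonedge_row b k) <-> exists2 a, (a < k)%N & C = ord_pair a b.
Proof.
elim: k C => [|k IHk] C /=; first by split=> // -[].
rewrite inE; split=> [/orP[/eqP ->|/IHk[a ak ->]]|[a ak ->]].
- by exists k.
- by exists a; rewrite // ltnW.
- by have [->|ne] := eqVneq a k; rewrite ?eqxx //; apply/orP; right; apply/IHk;
    exists a; rewrite // ltn_neqAle ne.
Qed.

Lemma mem_nonedge_gens b C : C \in unzip1 (nonedge_gens b) <->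
  exists a b', [/\ (a + 3 <= b')%N, (b' < b)%N & C = ord_pair a b'].
Proof.
elim: b C => [|b IHb] C /=; first by split=> // -[a [b' []]].
rewrite /unzip1 map_cat mem_cat -!/(unzip1 _); split=> [/orP[]|[a [b' [ab bb ->]]]].
- by case/mem_nonedge_row => a ab ->; exists a, b; split=> //; lia.
- by case/IHb => a [b' [ab bb ->]]; exists a, b'; split=> //; lia.
have [bE|ne] := eqVneq b' b; apply/orP; [left|right].
  by rewrite bE; apply/mem_nonedge_row; exists a => //; lia.
by apply/IHb; exists a, b'; split=> //; lia.
Qed.

Lemma nonedge_row_linear_quotients b k : (k <= b - 2)%N -> (b < n)%N ->
  linear_quotients (nonedge_gens b) ->
  linear_quotients (nonedge_row b k ++ nonedge_gens b).
Proof.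
move=> kb bn lqb; elim: k kb => //= k IHk kb; split; last by apply: IHk; lia.
- move=> C; rewrite /unzip1 map_cat mem_cat -!/(unzip1 _) => /orP[].
    case/mem_nonedge_row => a ak ->; have an : (a < n)%N by lia.
    by apply/set0Pn; exists (Ordinal an); rewrite !inE /=; lia.
  case/mem_nonedge_gens => a [b' [ab bb ->]].
  have [an bn'] : (a < n)%N /\ (b' < n)%N by lia.
  have [ak|ka] := ltnP a k; apply/set0Pn.
    by exists (Ordinal an); rewrite !inE /=; lia.
  by exists (Ordinal bn'); rewrite !inE /=; lia.
- move=> v; rewrite !inE => vV; have vn := ltn_ord v.
  have [vk|kv] := ltnP v k.
    exists (ord_pair v b); last first.
      by apply/setP => i; rewrite !inE -(inj_eq val_inj) /=; lia.
    rewrite /unzip1 map_cat mem_cat -!/(unzip1 _); apply/orP; left.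
    by apply/mem_nonedge_row; exists v.
  exists (ord_pair k v); last first.
    by apply/setP => i; rewrite !inE -(inj_eq val_inj) /=; lia.
  rewrite /unzip1 map_cat mem_cat -!/(unzip1 _); apply/orP; right.
  by apply/mem_nonedge_gens; exists k, v; split=> //; lia.
Qed.

Lemma nonedge_linear_quotients b : (b <= n)%N -> linear_quotients (nonedge_gens b).
Proof.
elim: b => //= b IHb bn; apply: nonedge_row_linear_quotients => //.
by apply: IHb; lia.
Qed.

Lemma nonedge_gens_card C : C \in unzip1 (nonedge_gens n) -> #|C| = 2%N.
Proof. by case/mem_nonedge_gens => a [b [ab bn ->]]; apply: card_ord_pair; lia. Qed.

Lemma sum_nonedge_row b k i : (k <= b - 2)%N -> (b < n)%N ->
  (\sum_(V <- unzip2 (nonedge_row b k)) 'C(#|V|, i) = k * 'C(b - 3, i))%N.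
Proof.
move=> kb bn; elim: k kb => [|k IHk] kb /=; first by rewrite big_nil.
rewrite big_cons IHk ?mulSn; last by lia.
congr ('C(_, i) + _)%N; rewrite cardsU !card_ord_interval; try lia.
rewrite (_ : _ :&: _ = set0) ?cards0; first by lia.
by apply/setP => j; rewrite !inE; lia.
Qed.

Lemma sum_nonedge_gens b i : (b <= n)%N ->
  (\sum_(V <- unzip2 (nonedge_gens b)) 'C(#|V|, i) = i.+1 * 'C(b - 2, i.+2))%N.
Proof.
elim: b => [|b IHb] bn; first by rewrite big_nil muln0.
rewrite /= /unzip2 map_cat big_cat /= sum_nonedge_row // IHb; last by lia.
have [b2|b3] := leqP b 2.
  have -> : (b - 2 = 0)%N by lia.
  by rewrite mul0n !bin_small ?muln0 //; lia.
case: b b3 {IHb bn} => [|[|[|t]]] // _.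
have [-> -> ->] : [/\ t.+3 - 2 = t.+1, t.+3 - 3 = t & t.+4 - 2 = t.+2]%N.
  by split; lia.
rewrite [in RHS]binS mulnDr addnC; congr (_ + _)%N.
exact: (mul_bin_diag t.+1 i).
Qed.

Definition triple k : {set 'I_n} := ord_interval k (k + 3).

Definition triple_gen k : {set 'I_n} * {set 'I_n} :=
  (~: triple k, [set i : 'I_n | (0 < k)%N && (i == k + 2 :> nat)%N]).

Fixpoint triple_gens k :=
  if k is k'.+1 then triple_gen k' :: triple_gens k' else [::].

Lemma mem_triple_gens k C :
  C \in unzip1 (triple_gens k) <-> exists2 j, (j < k)%N & C = ~: triple j.
Proof.
elim: k C => [|k IHk] C /=; first by split=> // -[].
rewrite inE; split=> [/orP[/eqP ->|/IHk[j jk ->]]|[j jk ->]].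
- by exists k.
- by exists j; rewrite // ltnW.
- by have [->|ne] := eqVneq j k; rewrite ?eqxx //; apply/orP; right; apply/IHk;
    exists j; rewrite // ltn_neqAle ne.
Qed.

Lemma triple_linear_quotients k : (k <= n - 2)%N -> linear_quotients (triple_gens k).
Proof.
elim: k => //= k IHk kn; split; last by apply: IHk; lia.
- move=> C /mem_triple_gens [j jk ->].
  have k2n : (k + 2 < n)%N by lia.
  by apply/set0Pn; exists (Ordinal k2n); rewrite !inE /=; lia.
- move=> v; rewrite inE => vk; exists (~: triple k.-1).
    by apply/mem_triple_gens; exists k.-1 => //; lia.
  by apply/setP => i; rewrite !inE -(inj_eq val_inj) /=; lia.
Qed.

Lemma triple_gens_card C : C \in unzip1 (triple_gens (n - 2)) -> #|C| = (n - 3)%N.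
Proof.
case/mem_triple_gens => j jn ->.
by rewrite cardsCs setCK card_ord card_ord_interval; lia.
Qed.

Lemma sum_triple_gens k i : (k <= n - 2)%N ->
  (\sum_(V <- unzip2 (triple_gens k)) 'C(#|V|, i) =
   if i == 0 then k else if i == 1 then k.-1 else 0)%N.
Proof.
elim: k => [|k IHk] kn; first by rewrite big_nil; case: i => [|[|i]].
rewrite big_cons IHk; last by lia.
have -> : #|[set i : 'I_n | (0 < k)%N && (i == k + 2 :> nat)%N]| = (0 < k)%N.
  case: k kn {IHk} => [|k] kn /=.
    by apply/eqP; rewrite cards_eq0; apply/eqP/setP => j; rewrite !inE.
  have k2n : (k.+1 + 2 < n)%N by lia.
  rewrite (_ : [set _ | _] = [set Ordinal k2n]) ?cards1 //.
  by apply/setP => j; rewrite !inE -(inj_eq val_inj).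
by case: k {kn IHk} => [|k]; case: i => [|[|i]].
Qed.

Lemma contains_nonedgeP A : reflect
  (exists u v : 'I_n, [/\ u \in A, v \in A & (u + 3 <= v)%N])
  (contains_some (nonedge_gens n) A).
Proof.
apply: (iffP hasP).
  case=> C /mem_nonedge_gens [a [b [ab bn ->]]] sA.
  have an : (a < n)%N by lia.
  exists (Ordinal an), (Ordinal bn); split=> //; apply: (subsetP sA).
    by rewrite inE /= eqxx.
  by rewrite inE /= eqxx orbT.
case=> u [v [uA vA uv]].
exists (ord_pair u v); first by apply/mem_nonedge_gens; exists u, v.
apply/subsetP => i; rewrite inE => /orP[/eqP/val_inj->|/eqP/val_inj->] //.
Qed.

Lemma contains_nonedge A :
  contains_some (nonedge_gens n) A = ~~ clique (path_square n) A.
Proof.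
apply/contains_nonedgeP/idP => [[u [v [uA vA uv]]]|].
  apply/negP => /forall_inP/(_ u uA)/forall_inP/(_ v vA).
  by rewrite /path_square -(inj_eq val_inj) /=; lia.
rewrite negb_forall_in => /exists_inP [u uA].
rewrite negb_forall_in => /exists_inP [v vA].
rewrite negb_imply /path_square -(inj_eq val_inj) /= => uv.
have [le_uv|lt_vu] := leqP u v; first by exists u, v; split=> //; lia.
by exists v, u; split=> //; lia.
Qed.

Lemma clique_triple A : (3 <= n)%N ->
  clique (path_square n) A = [exists k : 'I_(n - 2), A \subset triple k].
Proof.
move=> n3; apply/idP/existsP => [Acl|[k /subsetP sA]]; last first.
  rewrite -[clique _ _]negbK -contains_nonedge; apply/negP => /contains_nonedgeP.
  by case=> u [v [/sA + /sA]]; rewrite !inE; lia.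
have noedge u v : u \in A -> v \in A -> ~~ (u + 3 <= v)%N.
  move=> uA vA; apply: contraL Acl => uv; rewrite -contains_nonedge.
  by apply/contains_nonedgeP; exists u, v.
have [->|/set0Pn [u0 u0A]] := eqVneq A set0.
  have k0 : (0 < n - 2)%N by lia.
  by exists (Ordinal k0); rewrite sub0set.
case: (arg_minnP (fun u : 'I_n => u : nat) u0A) => u uA umin.
have kn : (minn u (n - 3) < n - 2)%N by lia.
exists (Ordinal kn); apply/subsetP => v vA; rewrite inE /=.
by have := umin v vA; have := noedge u v uA vA; have := ltn_ord v; lia.
Qed.

Lemma meets_allE (L : seq ({set 'I_n} * {set 'I_n})) A :
  meets_all L A = ~~ contains_some L (~: A).
Proof.
rewrite /meets_all /contains_some -all_predC; apply: eq_all => C /=.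
by rewrite setI_eq0 disjoints_subset.
Qed.

Lemma contains_triple A : (3 <= n)%N ->
  contains_some (triple_gens (n - 2)) A = clique (path_square n) (~: A).
Proof.
move=> n3; rewrite clique_triple //; apply/hasP/existsP.
  case=> C /mem_triple_gens [k kn ->]; rewrite -setCS setCK => sA.
  by exists (Ordinal kn).
case=> k sA; exists (~: triple k); last by rewrite -setCS setCK.
by apply/mem_triple_gens; exists k.
Qed.

Lemma total_cutE A :
  (A \in total_cut_complex (path_square n) 2) = ~~ clique (path_square n) (~: A).
Proof.
rewrite inE -contains_nonedge; apply/existsP/contains_nonedgeP.
  case=> M /and3P[Mind /cards2P[u [v [uv ME]]] sAM].
  have uM : u \in M by rewrite ME !inE eqxx.
  have vM : v \in M by rewrite ME !inE eqxx orbT.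
  have sMA : M \subset ~: A by rewrite -setCS setCK.
  have := forall_inP (forall_inP Mind u uM) v vM.
  rewrite /path_square => e_uv; move: uv; rewrite -(inj_eq val_inj) /= => uv.
  have [uA vA] := (subsetP sMA u uM, subsetP sMA v vM).
  have [le_uv|lt_vu] := leqP u v; first by exists u, v; split=> //; lia.
  by exists v, u; split=> //; lia.
case=> u [v [uA vA uv]]; exists [set u; v]; apply/and3P; split.
- apply/forall_inP => x; rewrite !inE => xuv; apply/forall_inP => y; rewrite !inE.
  by move: xuv => /orP[]/eqP-> /orP[]/eqP->; rewrite /path_square; lia.
- by rewrite cards2 -(inj_eq val_inj) /=; apply/eqP; lia.
- by rewrite -setCS setCK subUset !sub1set uA vA.
Qed.

Lemma cliqueS A C : A \subset C -> clique (path_square n) C ->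
  clique (path_square n) A.
Proof.
move=> /subsetP sAC /forall_inP Ccl; apply/forall_inP => u /sAC uC.
apply/forall_inP => v /sAC vC; exact: (forall_inP (Ccl u uC)).
Qed.

Variable F : fieldType.

Lemma sr_ideal_clique :
  sr_ideal F (clique_complex (path_square n)) =
  support_ideal (contains_some (nonedge_gens n)).
Proof.
rewrite sr_ideal_support => [|A C sAC]; last by rewrite !inE; apply: cliqueS.
by apply: eq_support_ideal => A; rewrite inE contains_nonedge.
Qed.

Lemma sr_ideal_clique_dual : (3 <= n)%N ->
  sr_ideal F (clique_complex (path_square n)) =
  support_ideal (meets_all (triple_gens (n - 2))).
Proof.
move=> n3; rewrite sr_ideal_clique; apply: eq_support_ideal => A.
by rewrite meets_allE contains_triple // setCK contains_nonedge.
Qed.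

Lemma sr_ideal_cut_dual :
  sr_ideal F (total_cut_complex (path_square n) 2) =
  support_ideal (meets_all (nonedge_gens n)).
Proof.
rewrite sr_ideal_support => [|A C sAC]; last first.
  by rewrite !total_cutE; apply: contraNN; apply: cliqueS; rewrite setCS.
by apply: eq_support_ideal => A; rewrite total_cutE meets_allE contains_nonedge.
Qed.

Lemma sr_ideal_cut : (3 <= n)%N ->
  sr_ideal F (total_cut_complex (path_square n) 2) =
  support_ideal (contains_some (triple_gens (n - 2))).
Proof.
move=> n3; rewrite sr_ideal_cut_dual; apply: eq_support_ideal => A.
by rewrite meets_allE contains_triple // contains_nonedge negbK.
Qed.

End PathSquare.

Lemma linear_quotients_linear (F : fieldType) n
    (L : seq ({set 'I_n} * {set 'I_n})) s : (0 < s)%N ->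
    linear_quotients L -> (forall B, B \in unzip1 L -> #|B| = s) ->
  linear_resolution (support_ideal (F := F) (contains_some L)).
Proof.
move=> s_gt0 Llq Ls; have II := support_ideal_ideal F (@contains_some_up _ L).
exists s; split; last first.
  move=> [//|i] j _ ne; rewrite (linear_resolution_betti _ _ II _ s_gt0
    (linear_quotients_resolution F Llq Ls)); last exact: support_ideal_homog.
  by rewrite ifN //=; apply: contra ne => /eqP ->; apply/eqP; lia.
apply/seteqP; split; last by apply: sub_ideal_gen => // p [].
apply: support_ideal_sub; first exact: ideal_gen_ideal.
move=> m /hasP [B BL sBm]; rewrite (setmon_dvd _ sBm).
apply: (is_idealM _ (ideal_gen_ideal _)); apply: mem_ideal_gen; split.
  by apply/support_idealX; rewrite mnm_supp_ind; apply/hasP; exists B.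
by rewrite -(Ls B BL); apply: setmon_homog.
Qed.

Lemma nonedge_betti_formula (n i : nat) : (1 <= i <= n - 3)%N ->
  (i * 'C(n - 2, i.+1))%N%:Z =
  - (binz n (i%:Z + 1) - n%:Z * binz (n - 1) i%:Z
     + (2 * n%:Z - 3) * binz (n - 2) (i%:Z - 1)
     - (n%:Z - 2) * binz (n - 3) (i%:Z - 2)).
Proof.
case: i => [//|k] kn; have [m nE] : exists m, n = (m + 3)%N by exists (n - 3)%N; lia.
have km : (k.+1 <= m)%N by lia.
have -> : (k.+1%:Z + 1 = k.+2%:Z)%R by lia.
have -> : (k.+1%:Z - 1 = k%:Z)%R by lia.
have -> : (n - 2 = m.+1)%N by lia.
have -> : (n - 1 = m.+2)%N by lia.
have -> : (n - 3 = m)%N by lia.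
have nZ : n%:Z = m%:Z + 3 by lia.
have -> : n = m.+3 by lia.
have H : (k%:Z + 2) * 'C(m, k.+2)%:Z = (m%:Z - k%:Z - 1) * 'C(m, k.+1)%:Z.
  have := mul_bin_left m k.+1; move/(congr1 Posz); rewrite !PoszM.
  by rewrite -subzn //; lia.
rewrite [LHS]PoszM /binz.
case: k kn km H => [|k] kn km H.
  by rewrite !binS !bin0 !PoszD /=; lia.
rewrite (_ : (k.+2%:Z - 2 = k%:Z)%R); last by lia.
by rewrite !binS !PoszD; lia.
Qed.

(* The two lists of Betti numbers are attached to the complexes they actually
   belong to, with corrected sign and internal degrees, and 4 <= n is assumed;
   see NOTES.md for why the printed version is false for every n. *)
Theorem theorem26 (F : fieldType) (n : nat) (n_ge4 : (4 <= n)%N) :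
  let I_cut := sr_ideal F (total_cut_complex (path_square n) 2) in
  let I_clique := sr_ideal F (clique_complex (path_square n)) in
  [/\ cohen_macaulay I_cut,
      linear_resolution I_cut
    & [/\ total_betti I_cut 0 = betti I_cut 0 0 /\ betti I_cut 0 0 = 1%N,
          total_betti I_cut 1 = betti I_cut 1 (n - 3) /\
            betti I_cut 1 (n - 3) = (n - 2)%N,
          total_betti I_cut 2 = betti I_cut 2 (n - 2) /\
            betti I_cut 2 (n - 2) = (n - 3)%N
        & forall i j, (3 <= i)%N -> betti I_cut i j = 0%N]] /\
  [/\ linear_resolution I_clique,
      forall i, (1 <= i <= n - 3)%N ->
        (betti I_clique i i.+1)%:Z =
        - (binz n (i%:Z + 1) - n%:Z * binz (n - 1) i%:Z
           + (2 * n%:Z - 3) * binz (n - 2) (i%:Z - 1)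
           - (n%:Z - 2) * binz (n - 3) (i%:Z - 2)),
      forall i j, (n - 3 < i)%N -> betti I_clique i j = 0%N
    & cohen_macaulay I_clique].
Proof.
have n3 : (3 <= n)%N by lia.
have lq1 := nonedge_linear_quotients (leqnn n).
have lq2 := triple_linear_quotients (leqnn (n - 2)).
move=> I_cut I_clique.
have cutE : I_cut = support_ideal (contains_some (triple_gens n (n - 2))).
  exact: sr_ideal_cut.
have cliqueE : I_clique = support_ideal (contains_some (nonedge_gens n n)).
  exact: sr_ideal_clique.
have s_gt0 : (0 < n - 3)%N by lia.
have cutI : is_ideal I_cut.
  by rewrite cutE; apply/support_ideal_ideal/contains_some_up.
have cliqueI : is_ideal I_clique.
  by rewrite cliqueE; apply/support_ideal_ideal/contains_some_up.
have cuth : homog_closed I_cut by rewrite cutE; apply: support_ideal_homog.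
have cliqueh : homog_closed I_clique by rewrite cliqueE; apply: support_ideal_homog.
have cutR := linear_quotients_resolution F lq2 (@triple_gens_card n).
have cliqueR := linear_quotients_resolution F lq1 (@nonedge_gens_card n).
rewrite -cutE in cutR; rewrite -cliqueE in cliqueR.
have cutB i j := linear_resolution_betti i j cutI cuth s_gt0 cutR.
have cliqueB i j :=
  linear_resolution_betti i j cliqueI cliqueh (isT : (0 < 2)%N) cliqueR.
have cutT i := total_betti_linear i cutI cuth s_gt0 cutR.
split; split.
- rewrite /I_cut sr_ideal_cut_dual.
  apply: linear_quotients_cohen_macaulay lq1 (@nonedge_gens_card n) _.
  have : ord_pair n 0 3 \in unzip1 (nonedge_gens n n).
    by apply/mem_nonedge_gens; exists 0%N, 3%N.
  by case: (nonedge_gens n n).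
- by rewrite cutE; apply: linear_quotients_linear lq2 (@triple_gens_card n).
- split.
  + by rewrite cutT !cutB.
  + rewrite cutT !cutB /= addn0 eqxx; split=> //.
    exact: (sum_triple_gens 0 (leqnn _)).
  + have E : (n - 3 + 1 = n - 2)%N by lia.
    rewrite cutT !cutB /= E eqxx; split=> //.
    by rewrite sum_triple_gens //=; lia.
  + move=> [|[|[|i]]] // j _; rewrite cutB; case: ifP => // _.
    by rewrite sum_triple_gens.
- by rewrite cliqueE; apply: linear_quotients_linear lq1 (@nonedge_gens_card n).
- move=> i /[dup] /andP[i1 _] /nonedge_betti_formula <-.
  case: i i1 => // i _; rewrite cliqueB /= add2n eqxx.
  by rewrite sum_nonedge_gens.
- move=> [|i] j; first by lia.
  move=> ni; rewrite cliqueB; case: ifP => // _.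
  by rewrite sum_nonedge_gens // bin_small ?muln0 //; lia.
- rewrite /I_clique sr_ideal_clique_dual //.
  apply: linear_quotients_cohen_macaulay lq2 (@triple_gens_card n) _.
  by have -> : (n - 2 = (n - 3).+1)%N by lia.
Qed.
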